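(* Let $\mathbb{F}$ be a field of characteristic zero and let $(\mathcal{L},\mathcal{H})$ be a locally finite simple admissible Lie algebra over $\mathbb{F}$ all of whose weight spaces $\mathcal{L}_\alpha$ ($\alpha\in R$) are finite dimensional, where $R\subseteq\mathcal{H}^\star\setminus\{0\}$ is the root system of $\mathcal{L}$ with respect to $\mathcal{H}$. Then $R$ is an irreducible locally finite root system in $\operatorname{span}_{\mathbb{F}}R$. Next let $\{R_i\mid i\in I\}$ be the class of all finite irreducible closed subsystems of $R$, and for $i\in I$ set $$\mathcal{L}_i:=\sum_{\alpha\in R_i}[\mathcal{L}_\alpha,\mathcal{L}_{-\alpha}]\oplus\sum_{\alpha\in R_i}\mathcal{L}_\alpha,\qquad \mathcal{H}_i:=\mathcal{H}\cap\mathcal{L}_i .$$ Then $\mathcal{H}$ is a maximal toral subalgebra of $\mathcal{L}$, and for every $i\in I$, $\mathcal{H}_i$ is a maximal toral subalgebra of $\mathcal{L}_i$ and $(\mathcal{L}_i,\mathcal{H}_i)$ is a finite dimensional simple admissible Lie algebra with root system $R_i$ (roots being identified with their restrictions to $\mathcal{H}_i$). Moreover $\{R_i\mid i\in I\}$ and $\{\mathcal{L}_i\mid i\in I\}$ are directed systems with respect to inclusion, $R$ is the direct limit of $\{R_i\mid i\in I\}$, and $\mathcal{L}$ is the direct limit of $\{\mathcal{L}_i\mid i\in I\}$.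
   Context: All vector spaces and Lie algebras are over a field $\mathbb{F}$ of characteristic zero; $V^\star$ denotes the dual space. A Lie algebra is locally finite if every finite subset generates a finite dimensional subalgebra. Toral subalgebra: a nonzero subalgebra $\mathcal{H}$ of a Lie algebra $\mathcal{L}$ such that $\mathcal{L}=\bigoplus_{\alpha\in\mathcal{H}^\star}\mathcal{L}_\alpha$ with $\mathcal{L}_\alpha=\{x\in\mathcal{L}\mid [h,x]=\alpha(h)x\ \forall h\in\mathcal{H}\}$ (that is, ''toral'' means split toral; such $\mathcal{H}$ is abelian). Maximal means maximal under inclusion among toral subalgebras. The root system of $\mathcal{L}$ with respect to $\mathcal{H}$ is $R=\{\alpha\in\mathcal{H}^\star\setminus\{0\}\mid\mathcal{L}_\alpha\ne\{0\}\}$; the spaces $\mathcal{L}_\alpha$, $\alpha\in R$, are called weight spaces. Admissible: $(\mathcal{L},\mathcal{H})$, with $\mathcal{H}$ a nonzero toral subalgebra of $\mathcal{L}$ and $R$ the root system, is admissible if $\mathcal{H}\subseteq\sum_{\alpha\in R}[\mathcal{L}_\alpha,\mathcal{L}_{-\alpha}]$ and for every $\alpha\in R$ and $0\neq x\in\mathcal{L}_\alpha$ there is $y\in\mathcal{L}_{-\alpha}$ such that $h:=[x,y]\in\mathcal{H}$ and $(x,h,y)$ is an $\mathfrak{sl}_2$-triple, i.e. $[h,x]=2x$, $[h,y]=-2y$, $[x,y]=h$. Locally finite root system in a nontrivial vector space $\mathcal{V}$: a subset $R\subseteq\mathcal{V}$ such that (i) $0\notin R$, $R$ spans $\mathcal{V}$,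 and $R$ is locally finite, i.e. $R\cap W$ is finite for every finite dimensional subspace $W$ of $\mathcal{V}$; (ii) for every $\alpha\in R$ there is $\check\alpha\in\mathcal{V}^\star$ with $\check\alpha(\alpha)=2$ and $s_\alpha(\beta)\in R$ for all $\beta\in R$, where $s_\alpha(v)=v-\check\alpha(v)\alpha$; (iii) $\check\alpha(\beta)\in\mathbb{Z}$ for all $\alpha,\beta\in R$. (The functionals $\check\alpha$ are uniquely determined.) A subsystem is a nonempty subset $S\subseteq R$ with $s_\alpha(\beta)\in S$ for all $\alpha,\beta\in S$. Two roots $\alpha,\beta$ are connected if there are finitely many roots $\alpha_1=\alpha,\alpha_2,\dots,\alpha_n=\beta$ with $\check\alpha_{i+1}(\alpha_i)\neq0$ for $1\le i\le n-1$; when speaking of irreducibility of a root system or subsystem, the roots of the chain are taken in that (sub)system. A (sub)system is irreducible if any two of its elements are connected. A subset $X\subseteq R$ is closed if $x,y\in X$ and $x+y\in R$ imply $x+y\in X$. *)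

(* Defs.v *)
From HB Require Import structures.
From mathcomp Require Import all_boot all_order all_algebra.
From mathcomp Require Import boolp classical_sets functions cardinality.

Set Implicit Arguments.
Unset Strict Implicit.
Unset Printing Implicit Defensive.

Import GRing.Theory.
Local Open Scope ring_scope.
Local Open Scope classical_set_scope.

HB.mixin Record Lmodule_isLie (F : fieldType) L of GRing.Lmodule F L := {
  lie : L -> L -> L;
  lie_linearl : forall y a x1 x2,
    lie (a *: x1 + x2) y = a *: lie x1 y + lie x2 y;
  lie_linearr : forall x a y1 y2,
    lie x (a *: y1 + y2) = a *: lie x y1 + lie x y2;
  lie_alt : forall x, lie x x = 0;
  lie_jacobi : forall x y z,
    lie x (lie y z) + lie y (lie z x) + lie z (lie x y) = 0
}.

#[short(type="lieAlgType")]
HB.structure Definition LieAlgebra (F : fieldType) :=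
  {L of Lmodule_isLie F L & GRing.Lmodule F L}.

Notation "[ 'lie' x , y ]" := (lie x y)
  (at level 0, x, y at level 200, format "[ 'lie'  x ,  y ]") : ring_scope.

Section LinearAlgebra.
Variables (F : fieldType) (V : lmodType F).
Implicit Types (A X : set V).

Definition is_subspace A : Prop :=
  A 0 /\ forall a x y, A x -> A y -> A (a *: x + y).

Definition lin_span X : set V := smallest is_subspace X.

Definition fin_dim A : Prop := exists2 X, finite_set X & A = lin_span X.

Definition subspace_sum (I : Type) (P : set I) (B : I -> set V) : set V :=
  lin_span (\bigcup_(i in P) B i).

Definition independent_family (I : choiceType) (B : I -> set V) : Prop :=
  forall (s : seq I) (x : I -> V), uniq s ->
    (forall i, i \in s -> B i (x i)) ->
    \sum_(i <- s) x i = 0 -> forall i, i \in s -> x i = 0.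

(* Only used when A is a subspace, where the hypothesis on a *: x + y is
   vacuous; stated this way, linearity on A restricts to every A `&` B. *)
Definition linear_on (W : lmodType F) A (f : V -> W) : Prop :=
  forall a x y, A x -> A y -> A (a *: x + y) ->
    f (a *: x + y) = a *: f x + f y.

Definition dual_pred A : {pred V -> F^o} :=
  fun f => `[< linear_on A f /\ forall x, ~ A x -> f x = 0 >].

Fact dual_pred_closed A : submod_closed (dual_pred A).
Proof.
split=> [|a f g /asboolP[lf f0] /asboolP[lg g0]]; apply/asboolP; split=> //.
- by move=> a x y _ _ _; rewrite scaler0 addr0.
- move=> b x y Ax Ay Axy; rewrite /= !fctE lf// lg//.
  by rewrite !scalerDr !scalerA [a * b]mulrC addrACA.
- by move=> x nAx; rewrite !fctE f0// g0// scaler0 addr0.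
Qed.

HB.instance Definition _ A :=
  GRing.isSubmodClosed.Build F (V -> F^o)%type (dual_pred A)
    (dual_pred_closed A).

(* The dual space of a subspace A of V. A functional on A is represented by
   its extension by zero to V, so that equality in dual A is equality of
   functionals on A. *)
Record dual A := Dual { dual_fun :> V -> F^o; dual_funP : dual_fun \in dual_pred A }.

HB.instance Definition _ A := [isSub for @dual_fun A].
HB.instance Definition _ A := [Choice of dual A by <:].
HB.instance Definition _ A := [SubChoice_isSubLmodule of dual A by <:].

Fact restrict_dual_subproof A (B : set V) (f : dual A) :
  (fun x => if `[< B x >] then f x else 0) \in dual_pred (A `&` B).
Proof.
have /asboolP[lf f0] := dual_funP f; apply/asboolP; split.
- move=> a x y [Ax Bx] [Ay By] [Axy Bxy].
  by rewrite !asboolT// lf.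
- move=> x nABx; case: asboolP => // Bx; apply: f0 => Ax; exact: nABx.
Qed.

Definition restrict_dual A (B : set V) (f : dual A) : dual (A `&` B) :=
  Dual (restrict_dual_subproof B f).

End LinearAlgebra.

Section RootSystems.
Variables (F : fieldType) (V : lmodType F).
Implicit Types (W R S : set V).

Definition reflection W (f : dual W) (a v : V) : V := v - f v *: a.

Definition is_coroot W R (a : V) (f : dual W) : Prop :=
  f a = 2 /\ forall b, R b -> R (reflection f a b).

Definition coroot W R (a : V) : dual W := xget 0 (is_coroot R a).

(* R is a locally finite root system in the subspace W. *)
Definition lf_root_system W R : Prop :=
  [/\ exists2 w, W w & w != 0,
      [/\ ~ R 0, lin_span R = W &
          forall D, is_subspace D -> D `<=` W -> fin_dim D ->
            finite_set (R `&` D)],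
      forall a, R a -> exists f : dual W, is_coroot R a f &
      forall a b, R a -> R b -> exists n : int, coroot W R a b = n%:~R].

Definition subsystem W R S : Prop :=
  [/\ S !=set0, S `<=` R &
      forall a b, S a -> S b -> S (reflection (coroot W R a) a b)].

Definition connected_in W R S (a b : V) : Prop :=
  exists s : seq V,
    [/\ {in a :: s, forall c, S c},
        path (fun x y => coroot W R y x != 0) a s &
        last a s = b].

Definition irreducible_in W R S : Prop :=
  forall a b, S a -> S b -> connected_in W R S a b.

Definition closed_in R S : Prop :=
  forall x y, S x -> S y -> R (x + y) -> S (x + y).

Definition fin_irr_closed_subsystem W R S : Prop :=
  [/\ subsystem W R S, finite_set S, irreducible_in W R S & closed_in R S].

End RootSystems.

Section LieAlgebras.
Variables (F : fieldType) (L : lieAlgType F).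
Implicit Types (A B H X : set L).

Definition is_subalgebra A : Prop :=
  is_subspace A /\ forall x y, A x -> A y -> A [lie x, y].

Definition locally_finite_lie A : Prop :=
  forall X, X `<=` A -> finite_set X -> fin_dim (smallest is_subalgebra X).

Definition lie_prod A B : set L :=
  lin_span [set [lie x, y] | x in A & y in B].

Definition is_ideal A X : Prop :=
  [/\ is_subspace X, X `<=` A &
      forall x y, A x -> X y -> X [lie x, y]].

Definition simple_lie A : Prop :=
  [/\ is_subalgebra A,
      exists x y, [/\ A x, A y & [lie x, y] != 0] &
      forall X, is_ideal A X -> X = [set 0] \/ X = A].

Definition weight_space A H (a : dual H) : set L :=
  [set x | A x /\ forall h, H h -> [lie h, x] = (a h : F) *: x].
Arguments weight_space A H a : clear implicits.

Definition toral A H : Prop :=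
  [/\ is_subalgebra H, H `<=` A, exists2 h, H h & h != 0,
      subspace_sum setT (weight_space A H) = A &
      independent_family (weight_space A H)].

Definition maximal_toral A H : Prop :=
  toral A H /\ forall H', toral A H' -> H `<=` H' -> H' = H.

Definition root_system A H : set (dual H) :=
  [set a | a != 0 /\ exists2 x, weight_space A H a x & x != 0].
Arguments root_system A H : clear implicits.

Definition admissible A H : Prop :=
  [/\ toral A H,
      H `<=` subspace_sum (root_system A H)
        (fun a => lie_prod (weight_space A H a) (weight_space A H (- a))) &
      forall a x, root_system A H a -> weight_space A H a x -> x != 0 ->
        exists y, [/\ weight_space A H (- a) y, H [lie x, y],
          [lie [lie x, y], x] = 2 *: x &
          [lie [lie x, y], y] = (- 2) *: y]].

(* The two summands of the algebra attached to a set S of roots: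
   the sums over S of the [L_a, L_(-a)], and of the L_a. *)
Definition cartan_part A H (S : set (dual H)) : set L :=
  subspace_sum S
    (fun a => lie_prod (weight_space A H a) (weight_space A H (- a))).
Arguments cartan_part A H S : clear implicits.

Definition root_part A H (S : set (dual H)) : set L :=
  subspace_sum S (weight_space A H).
Arguments root_part A H S : clear implicits.

Definition root_subalgebra A H (S : set (dual H)) : set L :=
  lin_span (cartan_part A H S `|` root_part A H S).
Arguments root_subalgebra A H S : clear implicits.

End LieAlgebras.

Arguments weight_space {F L} A H a.
Arguments root_system {F L} A H.
Arguments cartan_part {F L} A H S.
Arguments root_part {F L} A H S.
Arguments root_subalgebra {F L} A H S.

(* Families (A i) indexed by i in P, ordered by inclusion. *)
Definition directed_family (T I : Type) (P : set I) (A : I -> set T) : Prop :=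
  P !=set0 /\ forall i j, P i -> P j ->
    exists k, [/\ P k, A i `<=` A k & A j `<=` A k].

Section DirectLimits.
Variables (F : fieldType) (I : Type) (P : set I).

(* A morphism from a root system R to a root system R' is a linear map from
   the span of R to the span of R' sending roots to roots or to 0. *)
Definition rs_morphism (V V' : lmodType F) (R : set V) (R' : set V')
    (f : V -> V') : Prop :=
  linear_on (lin_span R) f /\ forall a, R a -> R' (f a) \/ f a = 0.

(* R, with the inclusion maps, is the direct limit of the subsets A i:
   it is their union, and has the universal property of the direct limit
   among locally finite root systems. *)
Definition rs_direct_limit (V : lmodType F) (A : I -> set V) (R : set V) :
    Prop :=
  R = \bigcup_(i in P) A i /\
  forall (V' : lmodType F) (R' : set V') (f : I -> V -> V'),
    lf_root_system (lin_span R') R' ->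
    (forall i, P i -> rs_morphism (A i) R' (f i)) ->
    (forall i j, P i -> P j -> A i `<=` A j ->
       {in lin_span (A i), f j =1 f i}) ->
    exists g : V -> V',
      [/\ rs_morphism R R' g,
          forall i, P i -> {in lin_span (A i), g =1 f i} &
          forall g' : V -> V', rs_morphism R R' g' ->
            (forall i, P i -> {in lin_span (A i), g' =1 f i}) ->
            {in lin_span R, g' =1 g}].

Definition lie_morphism (L M : lieAlgType F) (A : set L) (f : L -> M) : Prop :=
  linear_on A f /\
  forall x y, A x -> A y -> f [lie x, y] = [lie f x, f y].

Definition lie_direct_limit (L : lieAlgType F) (A : I -> set L) (B : set L) :
    Prop :=
  B = \bigcup_(i in P) A i /\
  forall (M : lieAlgType F) (f : I -> L -> M),
    (forall i, P i -> lie_morphism (A i) (f i)) ->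
    (forall i j, P i -> P j -> A i `<=` A j -> {in A i, f j =1 f i}) ->
    exists g : L -> M,
      [/\ lie_morphism B g,
          forall i, P i -> {in A i, g =1 f i} &
          forall g' : L -> M, lie_morphism B g' ->
            (forall i, P i -> {in A i, g' =1 f i}) ->
            {in B, g' =1 g}].

End DirectLimits.

(* Main.v *)
Require Import Defs.
From mathcomp Require Import all_boot all_order all_algebra finmap.
From mathcomp Require Import boolp classical_sets functions cardinality.
From mathcomp Require Import ring zify.

(** The argument replaces the structure theory of finite dimensional semisimple
    algebras by sl_2-triples, traces and one family of quadratic forms.

    Roots. A root vector x lies in an sl_2-triple (x, h, y) with h in H, and by
    local finiteness ad x and ad y are locally nilpotent. So weights take integral
    values on coroots ([weight_integral]) and are permuted by reflections
    ([weight_reflection]). Finitely many triples generate a finite dimensional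
    subalgebra; summing products of values over its finite set of weights gives an
    invariant integral form, positive definite modulo its kernel, on the coroots of
    the triples. The Cauchy-Schwarz inequality bounds the Cartan integers by 4
    ([cartan_integers]), and definiteness shows that a root in the span of given
    roots is determined by its values on their coroots ([root_determined]). This
    gives local finiteness, the uniqueness of coroots and the symmetry of
    orthogonality. A connected component of R spans, with its brackets, an ideal
    ([absorbing_ideal]), so R is irreducible and L is the sum of the root spaces
    and their brackets.

    Centers. The crucial point is that a subalgebra L_S has no center. A central
    element z of L_S is a sum of commutators that commute with it, so ad z is
    nilpotent on every finite dimensional subalgebra containing L_S, by a trace
    argument ([commutator_sum_nilpotent]). But an element of weight zero that acts
    nilpotently on a finite dimensional root space kills it: otherwise an sl_2-triple
    exhibits a nonzero scalar as a commutator ([ad_nilpotent_wt0]). So z centralizes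
    L, which is simple. Simplicity of L_S follows from this and from the
    connectedness of S ([LS_simple]).

    Maximality. Let H' be toral in L_S and contain H_S. If two weights of H'
    restricted to the same root, sl_2-theory would produce infinitely many of them in
    one finite dimensional root space; so each t in H' acts on root spaces by scalars.
    The invariant form of the finite system S yields an h in H_S with the same
    scalars ([scalar_action_in_H]), and t - h is central, hence zero.

    Limits. For a finite connected set T of roots, the roots in the span of T form a
    finite irreducible closed subsystem ([finite_roots_in_subsystem]). So the
    subsystems S and the algebras L_S are directed with unions R and L; the maximality
    of H follows from that of all the H_S, and the universal properties amount to
    gluing maps along a directed union. *)

Set Implicit Arguments.
Unset Strict Implicit.
Unset Printing Implicit Defensive.

Import Order.TTheory GRing.Theory Num.Theory.
Local Open Scope ring_scope.
Local Open Scope classical_set_scope.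

(** * Subspaces, spans and bases *)
Section Spans.
Variables (F : fieldType) (V : lmodType F).
Implicit Types (A B X Y : set V).

Lemma subspace0 A : is_subspace A -> A 0.
Proof. by case. Qed.

Lemma subspaceD A x y : is_subspace A -> A x -> A y -> A (x + y).
Proof. by move=> [_ h] Ax Ay; rewrite -[x]scale1r; apply: h. Qed.

Lemma subspaceZ A a x : is_subspace A -> A x -> A (a *: x).
Proof. by move=> [A0 h] Ax; rewrite -[_ *: _]addr0; apply: h. Qed.

Lemma subspaceN A x : is_subspace A -> A x -> A (- x).
Proof. by move=> sA Ax; rewrite -scaleN1r; apply: subspaceZ. Qed.

Lemma subspaceB A x y : is_subspace A -> A x -> A y -> A (x - y).
Proof. by move=> sA Ax Ay; apply: subspaceD => //; apply: subspaceN. Qed.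

Lemma subspace_big A (I : eqType) (s : seq I) (P : pred I) (f : I -> V) :
  is_subspace A -> (forall i, i \in s -> P i -> A (f i)) ->
  A (\sum_(i <- s | P i) f i).
Proof.
move=> sA Af; rewrite big_seq_cond; apply: big_ind => //.
- exact: subspace0.
- by move=> x y; apply: subspaceD.
- by move=> i /andP[]; apply: Af.
Qed.

Lemma subspaceI A B : is_subspace A -> is_subspace B -> is_subspace (A `&` B).
Proof.
move=> sA sB; split; first by split; apply: subspace0.
by move=> a x y [Ax Bx] [Ay By]; split; apply: subspaceD => //; apply: subspaceZ.
Qed.

Lemma subspace_set0 : is_subspace [set (0 : V)].
Proof. by split => // a x y /= -> ->; rewrite scaler0 addr0. Qed.

Lemma span_subspace X : is_subspace (lin_span X).
Proof.
split=> [M [[]]//|a x y hx hy M [sM XM]]; case: (sM) => _; apply.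
  by apply: hx; split.
by apply: hy; split.
Qed.

Lemma span_incl X : X `<=` lin_span X.
Proof. exact: sub_gen_smallest. Qed.

Lemma span_min X A : is_subspace A -> X `<=` A -> lin_span X `<=` A.
Proof. by move=> sA XA; apply: smallest_sub. Qed.

Lemma span_mono X Y : X `<=` Y -> lin_span X `<=` lin_span Y.
Proof.
move=> XY; apply: span_min; first exact: span_subspace.
by move=> x /XY; apply: span_incl.
Qed.

Lemma span_bigcup_directed (I : Type) (P : set I) (B : I -> set V) (x : V) :
    directed_family P B -> lin_span (\bigcup_(i in P) B i) x ->
  exists2 i, P i & lin_span (B i) x.
Proof.
move=> [[i0 Pi0] dir]; apply: (@span_min _ [set x | exists2 i, P i & lin_span (B i) x]).
  split; first by exists i0 => //; apply: subspace0; apply: span_subspace.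
  move=> a u v [i Pi Bu] [j Pj Bv]; have [k [Pk ik jk]] := dir i j Pi Pj.
  exists k => //; apply: (span_subspace _).2; first exact: span_mono Bu.
  exact: span_mono Bv.
by move=> u [i Pi Bu]; exists i => //; apply: span_incl.
Qed.

Lemma span_rangeP (n : nat) (b : 'I_n -> V) x :
  lin_span (range b) x <-> exists u : 'rV[F]_n, x = \sum_j u 0 j *: b j.
Proof.
split.
  apply: (@span_min _ [set x | exists u : 'rV[F]_n, x = \sum_j u 0 j *: b j]).
    split; first by exists 0; rewrite big1 // => j _; rewrite mxE scale0r.
    move=> a _ _ [u ->] [v ->]; exists (a *: u + v).
    rewrite scaler_sumr -big_split /=; apply: eq_bigr => j _.
    by rewrite !mxE scalerDl scalerA.
  move=> _ [i _ <-]; exists (delta_mx 0 i).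
  rewrite (bigD1 i) //= mxE !eqxx scale1r big1 ?addr0 // => j /negPf ji.
  by rewrite mxE ji andbF scale0r.
move=> [u ->]; apply: subspace_big; first exact: span_subspace.
move=> j _ _; apply: (subspaceZ _ (span_subspace _)).
by apply: span_incl; exists j.
Qed.

Lemma span_finP (s : seq V) x : lin_span [set` s] x ->
  exists u : 'rV[F]_(size s), x = \sum_j u 0 j *: s`_j.
Proof.
move=> sx; apply: (@span_rangeP _ (fun j : 'I_(size s) => s`_j) x).1.
apply: span_mono sx => y /= /(nthP 0)[i lti <-]; by exists (Ordinal lti).
Qed.

(** Steinitz: a relation among too many combinations of the spanning vectors
    is a vector in the kernel of their coefficient matrix. *)
Lemma free_size_bounded A : fin_dim A -> exists n, forall m (v : 'I_m -> V),
  (forall i, A (v i)) ->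
  (forall u : 'rV[F]_m, \sum_j u 0 j *: v j = 0 -> u = 0) -> (m <= n)%N.
Proof.
move=> [X /finite_seqP[s ->] ->]; exists (size s) => m v Av fv.
have [c cP] := choice (fun i => span_finP (Av i)).
pose M : 'M[F]_(m, size s) := \matrix_(i, j) c i 0 j.
rewrite leqNgt; apply/negP => lts.
have: kermx M != 0.
  rewrite -mxrank_eq0 mxrank_ker subn_eq0 -ltnNge.
  by apply: leq_ltn_trans lts; apply: rank_leq_col.
case/rowV0Pn => u /sub_kermxP uM /negP; apply; apply/eqP/fv.
under eq_bigr do rewrite cP scaler_sumr.
rewrite exchange_big /= big1 // => j _.
have := congr1 (fun N : 'rV_(size s) => N 0 j) uM; rewrite !mxE => uMj.
under eq_bigr do rewrite scalerA.
rewrite -scaler_suml -[X in X *: _]/(\sum_i _).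
rewrite (_ : \sum_i _ = 0) ?scale0r // -[RHS]uMj.
by apply: eq_bigr => i _; rewrite mxE.
Qed.

Definition frame n (b : 'I_n -> V) (u : 'rV[F]_n) : V := \sum_j u 0 j *: b j.

Lemma frame_lin n (b : 'I_n -> V) a u v :
  frame b (a *: u + v) = a *: frame b u + frame b v.
Proof.
rewrite /frame scaler_sumr -big_split /=; apply: eq_bigr => j _.
by rewrite !mxE scalerDl scalerA.
Qed.

(** The size of free families being bounded, take one of maximal size: a vector
    outside its span would extend it. *)
Lemma fin_dim_basis A : fin_dim A -> exists n (b : 'I_n -> V),
  injective (frame b) /\ forall x, A x <-> exists u, x = frame b u.
Proof.
move=> fA; have [N bnd] := free_size_bounded fA.
have sA : is_subspace A by case: fA => X _ ->; apply: span_subspace.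
pose free m := `[< exists v : 'I_m -> V, (forall i, A (v i)) /\
  (forall u : 'rV[F]_m, \sum_j u 0 j *: v j = 0 -> u = 0) >].
have ex0 : exists m, free m.
  exists 0%N; apply/asboolP; exists (fun _ => 0); split => [[]//|u _].
  by apply/rowP => -[].
have le_free m : free m -> (m <= N)%N.
  by move=> /asboolP[v [Av fv]]; apply: bnd fv.
case: (ex_maxnP ex0 le_free) => n /asboolP[b [Ab fb]] nmax.
have injb : injective (frame b).
  move=> u v uv; apply/eqP; rewrite -subr_eq0 -[u - v]addrC -scaleN1r; apply/eqP.
  by apply: fb; rewrite -/(frame _ _) frame_lin uv scaleN1r addNr.
exists n, b; split => // x; split; last first.
  by move=> [u ->]; apply: subspace_big => // j _ _; apply: subspaceZ.
move=> Ax; apply: contrapT => nx.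
suff: free n.+1 by move/nmax; rewrite ltnn.
apply/asboolP; exists (fun i => if unlift ord0 i is Some j then b j else x).
split=> [i|u]; first by case: unliftP.
rewrite big_ord_recl unlift_none.
under eq_bigr do rewrite liftK.
move=> h; have u0 : u 0 ord0 = 0.
  apply/eqP; apply: contrapT => /negP u0; apply: nx.
  exists (- (u 0 ord0)^-1 *: (\row_j u 0 (lift ord0 j))).
  rewrite -[frame _ _]addr0; transitivity (- (u 0 ord0)^-1 *: frame b (\row_j u 0 (lift ord0 j)) + frame b 0); last first.
    by rewrite -frame_lin !addr0.
  have -> : frame b 0 = 0 by rewrite /frame big1 // => j _; rewrite mxE scale0r.
  move/eqP: h; rewrite addr_eq0 => /eqP h; rewrite addr0.
  have -> : frame b (\row_j u 0 (lift ord0 j)) = - (u 0 ord0 *: x).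
    by rewrite h opprK; apply: eq_bigr => j _; rewrite mxE.
  by rewrite scalerN scaleNr opprK scalerA mulVf ?scale1r.
move: h; rewrite u0 scale0r add0r => h.
have /fb /rowP v0 : \sum_j (\row_j u 0 (lift ord0 j)) 0 j *: b j = 0.
  by rewrite -[RHS]h; apply: eq_bigr => j _; rewrite mxE.
apply/rowP => i; rewrite !mxE; case: (unliftP ord0 i) => [j ->|->//].
by have := v0 j; rewrite !mxE.
Qed.

Lemma linear_comb (f : V -> V) n (c : 'I_n -> F) (v : 'I_n -> V) : linear f ->
  f (\sum_i c i *: v i) = \sum_i c i *: f (v i).
Proof.
move=> lf; elim/big_rec2: _ => [|i y1 y2 _ <-]; last exact: lf.
by have := lf (-1) 0 0; rewrite scaler0 addr0 scaleN1r addNr.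
Qed.

(** Row vectors of coordinates, so composition of operators becomes the
    product of their matrices in the opposite order. *)
Lemma frame_operator A n (b : 'I_n -> V) (f : V -> V) :
    (forall x, A x <-> exists u, x = frame b u) -> linear f ->
    (forall x, A x -> A (f x)) ->
  exists M : 'M[F]_n, forall u, f (frame b u) = frame b (u *m M).
Proof.
move=> Ab lf fA; have Abj j : A (b j).
  apply/Ab; exists (delta_mx 0 j); rewrite /frame (bigD1 j) //= mxE !eqxx scale1r.
  by rewrite big1 ?addr0 // => i /negPf ij; rewrite mxE ij andbF scale0r.
have [c cP] := choice (fun j => (Ab _).1 (fA _ (Abj j))).
exists (\matrix_(i, j) c i 0 j) => u.
rewrite /frame linear_comb //.
transitivity (\sum_i \sum_j (u 0 i * c i 0 j) *: b j).
  apply: eq_bigr => i _; rewrite cP /frame scaler_sumr.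
  by apply: eq_bigr => j _; rewrite scalerA.
rewrite exchange_big /=; apply: eq_bigr => j _.
rewrite -scaler_suml mxE; congr (_ *: _).
by apply: eq_bigr => i _; rewrite !mxE.
Qed.

Lemma fin_dimU A B : fin_dim A -> fin_dim B -> fin_dim (lin_span (A `|` B)).
Proof.
move=> [X fX ->] [Y fY ->]; exists (X `|` Y); first by rewrite finite_setU.
apply/seteqP; split; apply: span_min; try exact: span_subspace.
  by move=> x []; apply: span_mono => y; [left|right].
by move=> x [Xx|Yx]; apply: span_incl; [left|right]; apply: span_incl.
Qed.

Lemma fin_dim_sum (I : choiceType) (P : set I) (B : I -> set V) :
  finite_set P -> (forall i, P i -> fin_dim (B i)) -> fin_dim (subspace_sum P B).
Proof.
move=> fP fB.
have /choice[X XP] i : exists Xi, P i -> finite_set Xi /\ B i = lin_span Xi.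
  have [Pi|nPi] := pselect (P i); last by exists set0.
  by have [Xi ? ?] := fB i Pi; exists Xi.
exists (\bigcup_(i in P) X i).
  by apply: bigcup_finite => // i Pi; apply: (XP i Pi).1.
apply/seteqP; split; apply: span_min; try exact: span_subspace.
  move=> x [i Pi]; rewrite (XP i Pi).2; apply: span_mono => y Xy; by exists i.
move=> x [i Pi Xx]; apply: span_incl; exists i => //.
by rewrite (XP i Pi).2; apply: span_incl.
Qed.

Lemma subspace_sum_comb (I : eqType) (P : set I) (B : I -> set V) x :
  (forall i, is_subspace (B i)) -> subspace_sum P B x ->
  exists (s : seq I) (u : I -> V), [/\ uniq s, (forall i, i \in s -> P i),
    (forall i, B i (u i)) & x = \sum_(i <- s) u i].
Proof.
move=> sB; apply: (@span_min _ [set x | exists s u, [/\ uniq s,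
  (forall i, i \in s -> P i), (forall i, B i (u i)) & x = \sum_(i <- s) u i]]).
  split; first by exists [::], (fun _ => 0); split => // [i|]; [apply: subspace0|rewrite big_nil].
  move=> c _ _ [s [u [us sP uB ->]]] [t [w [ut tP wB ->]]].
  pose f (r : seq I) (v : I -> V) i := if i \in r then v i else 0.
  have fE (r r' : seq I) v : uniq r -> uniq r' -> {subset r <= r'} ->
      \sum_(i <- r) v i = \sum_(i <- r') f r v i.
    move=> ur ur' rr'; rewrite /f -big_mkcond -big_filter; apply: perm_big.
    apply: uniq_perm => //; first exact: filter_uniq.
    by move=> i; rewrite mem_filter; case: (boolP (i \in r)) => [/rr'->|].
  exists (undup (s ++ t)), (fun i => c *: f s u i + f t w i); split.
  - exact: undup_uniq.
  - by move=> i; rewrite mem_undup mem_cat => /orP[/sP|/tP].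
  - move=> i; apply: (sB i).2; rewrite /f; case: ifP => // _; exact: subspace0.
  rewrite big_split /= -scaler_sumr -!fE ?undup_uniq // => i;
    by rewrite mem_undup mem_cat => ->; rewrite ?orbT.
move=> y [i Pi Biy]; exists [:: i], (fun j => if j == i then y else 0); split => //.
- by move=> j; rewrite inE => /eqP->.
- by move=> j; case: eqP => [->//|_]; apply: subspace0.
- by rewrite big_seq1 eqxx.
Qed.

Lemma span_cover (X : set V) (s : seq V) : (forall x, x \in s -> lin_span X x) ->
  exists T : seq V, (forall t, t \in T -> X t) /\ forall x, x \in s -> lin_span [set` T] x.
Proof.
have span1 x : lin_span X x -> exists T : seq V, (forall t, t \in T -> X t) /\ lin_span [set` T] x.
  apply: (@span_min X [set x | exists T : seq V, (forall t, t \in T -> X t) /\ lin_span [set` T] x]).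
    split; first by exists [::]; split => //; apply: subspace0; apply: span_subspace.
    move=> c u v [T [TX Tu]] [T' [TX' Tv]]; exists (T ++ T'); split.
      by move=> t; rewrite mem_cat => /orP[/TX|/TX'].
    apply: (span_subspace _).2; [move: Tu|move: Tv]; apply: span_mono => t /=;
      by rewrite mem_cat => ->; rewrite ?orbT.
  move=> u Xu; exists [:: u]; split; first by move=> t; rewrite inE => /eqP->.
  by apply: span_incl; rewrite /= inE.
elim: s => [|x s IH] h; first by exists [::].
have [|T [TX Ts]] := IH; first by move=> y ys; apply: h; rewrite inE ys orbT.
have [|T' [TX' Tx]] := span1 x; first by apply: h; rewrite mem_head.
exists (T' ++ T); split; first by move=> t; rewrite mem_cat => /orP[/TX'|/TX].
move=> y; rewrite inE => /predU1P[->|/Ts].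
  by move: Tx; apply: span_mono => t /=; rewrite mem_cat => ->.
by apply: span_mono => t /=; rewrite mem_cat => ->; rewrite orbT.
Qed.

End Spans.

(** * Traces of commutators *)
Section Traces.
Variables (F : fieldType).
Hypothesis char0 : [pchar F] =i pred0.

Lemma natF_eq0 n : (n%:R == 0 :> F) = (n == 0)%N.
Proof. exact: (pcharf0P F).1. Qed.

(** A rank factorization E = C R of an idempotent satisfies R C = 1, and C R and
    R C have the same trace. *)
Lemma idempotent_trace n (E : 'M[F]_n) : E *m E = E -> \tr E = (\rank E)%:R.
Proof.
move=> idE; rewrite -[in LHS](mulmx_base E) mxtrace_mulC.
suff -> : row_base E *m col_base E = 1%:M by rewrite mxtrace1.
apply: (row_full_inj (col_base_full E)); apply: (row_free_inj (row_base_free E)).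
rewrite /= mulmx1 mulmx_base -[RHS]idE -[in RHS](mulmx_base E).
by rewrite !mulmxA.
Qed.

(** If the commuting sum of commutators Z were not nilpotent, a polynomial in Z
    without constant term would be a nonzero idempotent Z Q; but Q commutes with
    every X i, so Z Q is again a sum of commutators and its trace, which is the
    rank, vanishes. *)
Lemma commutator_sum_nilpotent n k (Z : 'M[F]_n) (X Y : 'I_k -> 'M[F]_n) :
  Z = \sum_i (X i *m Y i - Y i *m X i) -> (forall i, Z *m X i = X i *m Z) ->
  exists m, Z ^+ m = 0.
Proof.
case: n Z X Y => [|n] Z X Y ZE ZX; first by exists 0%N; apply/matrixP => -[].
(* The characteristic polynomial is q X^m with q prime to X; by Bezout,
   v X^(m+1) is 1 modulo q, so its value at Z is idempotent. *)
have [m [q]] := multiplicity_XsubC (char_poly Z) 0.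
rewrite (monic_neq0 (char_poly_monic Z)) /= subr0 => q0 pE.
have /Bezout_eq1_coprimepP[[u v] /= uv] : coprimep q ('X ^+ m.+1).
  by rewrite coprimep_expr // coprimepX.
have hZ p : horner_mx Z (p * q * 'X ^+ m) = 0.
  by rewrite -mulrA -pE rmorphM /= [horner_mx Z (char_poly Z)]Cayley_Hamilton mulr0.
pose Q := horner_mx Z (v * 'X ^+ m).
have QX i : Q *m X i = X i *m Q by apply: comm_horner_mx; apply: ZX.
have EE : horner_mx Z (v * 'X ^+ m.+1) = Q *m Z.
  by rewrite exprSr mulrA rmorphM /= horner_mx_X.
have trE : \tr (Q *m Z) = 0.
  rewrite ZE mulmx_sumr raddf_sum big1 //= => i _.
  rewrite mulmxBr raddfB /= [\tr (Q *m (Y i *m _))]mxtrace_mulC -mulmxA.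
  by rewrite [\tr (Y i *m _)]mxtrace_mulC !mulmxA QX subrr.
have idE : Q *m Z *m (Q *m Z) = Q *m Z.
  apply/eqP; rewrite -subr_eq0 -EE -[_ *m _]rmorphM -rmorphB /=.
  rewrite -[X in _ - X]mulr1 -mulrBr -[X in _ - X]uv opprD addrCA subrr addr0.
  rewrite mulrN rmorphN /= (_ : v * _ * (u * q) = v * 'X * u * q * 'X ^+ m) ?hZ ?oppr0 //.
  by rewrite exprS -!mulrA; congr (_ * (_ * _)); rewrite mulrC -!mulrA.
exists m; have /eqP := idempotent_trace idE.
rewrite trE eq_sym natF_eq0 mxrank_eq0 -EE => /eqP E0.
have := congr1 (horner_mx Z) (congr1 (fun p => p * 'X ^+ m) uv).
rewrite mul1r mulrDl rmorphD /= hZ add0r rmorphM /= E0 mul0r => /esym.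
by rewrite rmorphXn /= horner_mx_X.
Qed.

Section Operators.
Variables (V : lmodType F) (D : set V) (fD : fin_dim D).

Lemma commuting_commutator_sum_nilpotent k (z : V -> V) (x y : 'I_k -> V -> V) :
    linear z -> (forall i, linear (x i)) -> (forall i, linear (y i)) ->
    (forall v, D v -> D (z v)) -> (forall i v, D v -> D (x i v)) ->
    (forall i v, D v -> D (y i v)) ->
    (forall v, D v -> z v = \sum_i (x i (y i v) - y i (x i v))) ->
    (forall i v, D v -> z (x i v) = x i (z v)) ->
  exists m, forall v, D v -> iter m z v = 0.
Proof.
move=> lz lx ly zD xD yD zE zx; have [n [b [injb Db]]] := fin_dim_basis fD.
have [Z ZE] := frame_operator Db lz zD.
have /choice[X XE] i := frame_operator Db (lx i) (xD i).
have /choice[Y YE] i := frame_operator Db (ly i) (yD i).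
have Df u : D (frame b u) by apply/Db; exists u.
have bD u v : frame b (u + v) = frame b u + frame b v.
  by rewrite -{1}[u]scale1r frame_lin scale1r.
have b0 : frame b 0 = 0 by rewrite /frame big1 // => j _; rewrite mxE scale0r.
have bN u : frame b (- u) = - frame b u.
  by apply/eqP; rewrite -addr_eq0 -bD addNr b0.
have bsum k' (u : 'I_k' -> _) : frame b (\sum_i u i) = \sum_i frame b (u i).
  by elim/big_rec2: _ => // i u1 u2 _ <-; rewrite bD.
have rowE (M N : 'M[F]_n) : (forall u : 'rV_n, u *m M = u *m N) -> M = N.
  by move=> MN; apply/row_matrixP => i; rewrite !rowE MN.
(* Matrices act on rows, hence multiply in the opposite order to operators:
   the commutator of x i and y i has the matrix of the one of X i and - Y i. *)
have [||m Zm] := @commutator_sum_nilpotent n k Z X (fun i => - Y i).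
- apply: rowE => u; apply: injb; rewrite -ZE zE // mulmx_sumr bsum.
  apply: eq_bigr => i _.
  by rewrite YE !XE YE mulmxN mulNmx opprK addrC mulmxDr bD mulmxN bN !mulmxA.
- by move=> i; apply: rowE => u; apply: injb; rewrite !mulmxA -XE -!ZE -XE zx.
exists m => v /Db[u ->]; suff -> : iter m z (frame b u) = frame b (u *m Z ^+ m).
  by rewrite Zm mulmx0 b0.
by elim: m {Zm} => [|m IH]; rewrite ?expr0 ?mulmx1 //= IH ZE -mulmxA exprSr.
Qed.

(** A commutator has trace zero, and the trace of the scalar c is c times the
    dimension, which is nonzero in characteristic zero. *)
Lemma commutator_not_scalar (v0 : V) (z w : V -> V) (c : F) :
    D v0 -> v0 != 0 -> linear z -> linear w ->
    (forall v, D v -> D (z v)) -> (forall v, D v -> D (w v)) ->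
    (forall v, D v -> z (w v) - w (z v) = c *: v) -> c = 0.
Proof.
move=> Dv0 v00 lz lw zD wD zw; have [n [b [injb Db]]] := fin_dim_basis fD.
have [Z ZE] := frame_operator Db lz zD; have [M ME] := frame_operator Db lw wD.
have Df u : D (frame b u) by apply/Db; exists u.
have fD0 a u v : frame b (a *: u + v) = a *: frame b u + frame b v.
  exact: frame_lin.
have ZM : M *m Z - Z *m M = c%:M.
  apply/row_matrixP => i; rewrite !rowE; apply: injb.
  rewrite mulmxBr addrC -scaleN1r fD0 scaleN1r addrC !mulmxA -ZE -!ME -ZE zw //.
  rewrite mul_mx_scalar -[X in _ = frame b X]addr0 fD0.
  have -> : frame b 0 = 0 by rewrite /frame big1 // => j _; rewrite mxE scale0r.
  by rewrite addr0.
have := congr1 (fun N => \tr N) ZM.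
rewrite raddfB /= mxtrace_mulC subrr mxtrace_scalar => /esym/eqP.
rewrite -mulr_natl mulf_eq0 natF_eq0 => /orP[/eqP n0|/eqP //].
move/Db: Dv0 v00 => [u ->]; rewrite /frame big1 ?eqxx // => -[j ltj].
by exfalso; rewrite n0 in ltj.
Qed.

End Operators.
End Traces.

(** * Functionals on a subspace *)
Section Duals.
Variables (F : fieldType) (V : lmodType F) (A : set V).
Implicit Types (f g : dual A).

Lemma dualD f g x : (f + g) x = f x + g x. Proof. by []. Qed.
Lemma dualN f x : (- f) x = - f x. Proof. by []. Qed.
Lemma dualB f g x : (f - g) x = f x - g x. Proof. by []. Qed.
Lemma dualZ (c : F) f x : (c *: f) x = c * f x. Proof. by []. Qed.
Lemma dual0 x : (0 : dual A) x = 0. Proof. by []. Qed.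

Lemma dual_out f x : ~ A x -> f x = 0.
Proof. by have /asboolP[_] := dual_funP f; apply. Qed.

Lemma dual_lin f (c : F) x y : is_subspace A -> A x -> A y ->
  f (c *: x + y) = c * f x + f y.
Proof.
by move=> sA Ax Ay; have /asboolP[lf _] := dual_funP f; apply: lf => //; apply: sA.2.
Qed.

Lemma dual_eq f g : (forall x, A x -> f x = g x) -> f = g.
Proof.
move=> fg; apply: val_inj; apply: funext => x /=.
by have [/fg//|nAx] := pselect (A x); rewrite !dual_out.
Qed.

Lemma dual_neq f g : f != g -> exists2 x, A x & f x != g x.
Proof.
move=> fg; apply: contrapT => h; move/negP: fg; apply; apply/eqP.
apply: dual_eq => x Ax; apply/eqP; apply: contrapT => /negP fgx; apply: h.
by exists x.
Qed.

Lemma restrict_dualE (B : set V) f x : B x -> restrict_dual B f x = f x.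
Proof. by move=> Bx /=; rewrite asboolT. Qed.

Lemma dual_at0 f : is_subspace A -> f 0 = 0.
Proof.
move=> sA; have A0 := subspace0 sA.
by have := dual_lin f (-1) sA A0 A0; rewrite scaler0 addr0 mulN1r addNr.
Qed.

Lemma dual_scale f (c : F) x : is_subspace A -> A x -> f (c *: x) = c * f x.
Proof.
move=> sA Ax; have := dual_lin f c sA Ax (subspace0 sA).
by rewrite dual_at0 // !addr0.
Qed.

Lemma dual_comb f (I : eqType) (s : seq I) (c : I -> F) (x : I -> V) : is_subspace A ->
  (forall i, i \in s -> A (x i)) ->
  f (\sum_(i <- s) c i *: x i) = \sum_(i <- s) c i * f (x i).
Proof.
move=> sA; elim: s => [|i s IH] Ax; first by rewrite !big_nil dual_at0.
have Axs j : j \in s -> A (x j) by move=> js; apply: Ax; rewrite inE js orbT.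
rewrite !big_cons dual_lin ?IH //; first by apply: Ax; apply: mem_head.
by apply: subspace_big => // j js _; apply: subspaceZ => //; apply: Axs.
Qed.

Definition ev_dual_fun (W : set (dual A)) (h : V) (b : dual A) : F^o :=
  if `[< W b >] then b h else 0.

Lemma ev_dual_subproof (W : set (dual A)) (h : V) :
  ev_dual_fun W h \in dual_pred W.
Proof.
apply/asboolP; split=> [c x y Wx Wy Wxy|x nWx]; rewrite /ev_dual_fun; last by rewrite asboolF.
by rewrite !asboolT // dualD dualZ.
Qed.

(** Evaluation at h. The coroot of a root, a functional on the span of the roots,
    will be the evaluation at an element of the toral subalgebra. *)
Definition ev_dual (W : set (dual A)) (h : V) : dual W :=
  Dual (ev_dual_subproof W h).

Lemma ev_dualE (W : set (dual A)) (h : V) b : W b -> ev_dual W h b = b h.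
Proof. by move=> Wb /=; rewrite /ev_dual_fun asboolT. Qed.

End Duals.

(** * Brackets and representations of sl_2 *)
Section LieBasics.
Variables (F : fieldType) (L : lieAlgType F).
Implicit Types (x y z h v : L).

Lemma lie_linear x : linear (lie x). Proof. exact: lie_linearr. Qed.

Lemma lieDl x y z : [lie x + y, z] = [lie x, z] + [lie y, z].
Proof. by have := lie_linearl z 1 x y; rewrite !scale1r. Qed.
Lemma lieDr x y z : [lie x, y + z] = [lie x, y] + [lie x, z].
Proof. by have := lie_linearr x 1 y z; rewrite !scale1r. Qed.
Lemma lie0l x : [lie 0, x] = 0.
Proof. by apply: (addrI [lie 0, x]); rewrite -lieDl !addr0. Qed.
Lemma lie0r x : [lie x, 0] = 0.
Proof. by apply: (addrI [lie x, 0]); rewrite -lieDr !addr0. Qed.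
Lemma lieZl a x y : [lie a *: x, y] = a *: [lie x, y].
Proof. by have := lie_linearl y a x 0; rewrite lie0l !addr0. Qed.
Lemma lieZr a x y : [lie x, a *: y] = a *: [lie x, y].
Proof. by have := lie_linearr x a y 0; rewrite lie0r !addr0. Qed.
Lemma lieNl x y : [lie - x, y] = - [lie x, y].
Proof. by rewrite -scaleN1r lieZl scaleN1r. Qed.
Lemma lieNr x y : [lie x, - y] = - [lie x, y].
Proof. by rewrite -scaleN1r lieZr scaleN1r. Qed.
Lemma lieBl x y z : [lie x - y, z] = [lie x, z] - [lie y, z].
Proof. by rewrite lieDl lieNl. Qed.
Lemma lieC x y : [lie x, y] = - [lie y, x].
Proof.
have := lie_alt (x + y); rewrite lieDl !lieDr !lie_alt add0r addr0 => /eqP.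
by rewrite addr_eq0 => /eqP.
Qed.

Lemma lie_suml (I : Type) (s : seq I) (P : pred I) (f : I -> L) x :
  [lie \sum_(i <- s | P i) f i, x] = \sum_(i <- s | P i) [lie f i, x].
Proof. by elim/big_rec2: _ => [|i y1 y2 _ <-]; rewrite ?lie0l ?lieDl. Qed.
Lemma lie_sumr (I : Type) (s : seq I) (P : pred I) (f : I -> L) x :
  [lie x, \sum_(i <- s | P i) f i] = \sum_(i <- s | P i) [lie x, f i].
Proof. by elim/big_rec2: _ => [|i y1 y2 _ <-]; rewrite ?lie0r ?lieDr. Qed.

Lemma lie_derivation x y z : [lie x, [lie y, z]] = [lie [lie x, y], z] + [lie y, [lie x, z]].
Proof.
have := lie_jacobi x y z; rewrite [[lie z, x]]lieC lieNr [[lie z, _]]lieC.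
by move=> /eqP; rewrite subr_eq0 => /eqP <-; rewrite subrK.
Qed.

Lemma lie_bracketl x y z : [lie [lie x, y], z] = [lie x, [lie y, z]] - [lie y, [lie x, z]].
Proof. by rewrite lie_derivation addrK. Qed.

Lemma iter_lie0 x n : iter n (lie x) 0 = 0.
Proof. by elim: n => //= n ->; rewrite lie0r. Qed.

Definition sl2 x h y : Prop :=
  [/\ [lie h, x] = 2 *: x, [lie h, y] = (- 2) *: y & [lie x, y] = h].

Lemma sl2_swap x h y : sl2 x h y -> sl2 y (- h) x.
Proof.
move=> [hx hy xy]; split; first by rewrite lieNl hy scaleNr opprK.
  by rewrite lieNl hx scaleNr.
by rewrite lieC xy.
Qed.

Section Representation.
Hypothesis char0 : [pchar F] =i pred0.
Variables (x h y : L) (tri : sl2 x h y).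

Lemma sl2_weight_iter v c n : [lie h, v] = c *: v ->
  [lie h, iter n (lie y) v] = (c - 2 * n%:R) *: iter n (lie y) v.
Proof.
have [hx hy xy] := tri => hv; elim: n => [|n IH] /=; first by rewrite mulr0 subr0.
rewrite lie_derivation hy IH lieZl lieZr -scalerDl -natr1; congr (_ *: _).
by ring.
Qed.

Lemma sl2_raise_lower v c n : [lie h, v] = c *: v ->
  [lie x, iter n.+1 (lie y) v] =
  iter n.+1 (lie y) [lie x, v] + (n.+1%:R * (c - n%:R)) *: iter n (lie y) v.
Proof.
have [hx hy xy] := tri => hv; elim: n => [|n IH].
  by rewrite /= lie_derivation xy hv addrC subr0 mul1r.
rewrite iterS lie_derivation xy (sl2_weight_iter _ hv) IH lieDr lieZr -!iterS.
rewrite addrC -addrA -scalerDl; congr (_ + _ *: _).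
by rewrite -![_.+2%:R]natr1 -![_.+1%:R]natr1; ring.
Qed.

Lemma sl2_raise_weight v c : [lie h, v] = c *: v -> [lie h, [lie x, v]] = (c + 2) *: [lie x, v].
Proof.
have [hx _ _] := tri => hv; rewrite lie_derivation hx hv lieZl lieZr -scalerDl.
by rewrite addrC.
Qed.

(** Induction on the number of raising steps that kill v. If y^k killed v then,
    because x y^n - y^n x is a multiple of y^(n-1) on weight vectors, y^(k+2)
    would kill x v, a vector of weight k + 2 that is closer to the top. *)
Lemma sl2_lower_neq0 v k m : v != 0 -> [lie h, v] = k%:R *: v ->
  iter m (lie x) v = 0 -> iter k (lie y) v != 0.
Proof.
elim: m v k => [|m IH] v k v0 hv xv; first by move: v0; rewrite [v]xv eqxx.
have [xv0|xv0] := eqVneq [lie x, v] 0.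
  suff: forall j, (j <= k)%N -> iter j (lie y) v != 0 by apply.
  elim=> [//|j IHj ltjk]; apply/eqP => yj.
  have := sl2_raise_lower j hv; rewrite yj lie0r xv0 iter_lie0 add0r => /esym/eqP.
  rewrite scaler_eq0 (negPf (IHj (ltnW ltjk))) orbF mulf_eq0 natF_eq0 //=.
  by rewrite -natrB ?(ltnW ltjk) // natF_eq0 // subn_eq0 leqNgt ltjk.
apply/eqP => yk; have hxv := sl2_raise_weight hv.
have := IH _ k.+2 xv0; rewrite -iterSr => /(_ _ xv) /negP; apply.
  by rewrite hxv -[k.+2]addn2 natrD.
have yk1 : iter k.+1 (lie y) v = 0 by rewrite iterS yk lie0r.
have := sl2_raise_lower k.+1 hv.
by rewrite iterS yk1 scaler0 addr0 lie0r lie0r => <-.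
Qed.

(** Powers of x lead to a highest weight vector. If y^(n+1) is the first power of
    y that kills it, then x y^(n+1) = 0 forces its weight to be n. *)
Lemma sl2_weight_integral v c m : v != 0 -> [lie h, v] = c *: v ->
  iter m (lie x) v = 0 -> (forall u, exists n, iter n (lie y) u = 0) ->
  exists n : int, c = n%:~R.
Proof.
move=> v0 hv xv ynil; elim: m v c v0 hv xv => [|m IH] v c v0 hv xv.
  by move: v0; rewrite [v]xv eqxx.
have [xv0|xv0] := eqVneq [lie x, v] 0; last first.
  have [|n cn] := IH _ _ xv0 (sl2_raise_weight hv); first by rewrite -iterSr.
  by exists (n - 2); rewrite rmorphB /= -cn addrK.
have ex : exists n, iter n (lie y) v == 0 by have [n /eqP] := ynil v; exists n.
case: (ex_minnP ex) => -[|n] /eqP yn nmin; first by move: v0; rewrite [v]yn eqxx.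
have := sl2_raise_lower n hv; rewrite yn lie0r xv0 iter_lie0 add0r => /esym/eqP.
rewrite scaler_eq0 mulf_eq0 natF_eq0 //= subr_eq0 => /orP[/eqP->|/nmin].
  by exists n%:Z; rewrite pmulrn.
by rewrite ltnn.
Qed.

End Representation.
End LieBasics.

(** * Weight spaces of a toral subalgebra *)
Section WeightSpaces.
Variables (F : fieldType) (L : lieAlgType F).
Implicit Types (A H X : set L).

(** Applying ad h - phi_i h with h separating phi_i and phi_j kills the i-th
    term and rescales the j-th by a nonzero scalar. *)
Lemma weight_components H X (I : eqType) (phi : I -> L -> F) (s : seq I) (x : I -> L) :
    is_subspace X -> (forall h v, H h -> X v -> X [lie h, v]) -> uniq s ->
    (forall i j, i \in s -> j \in s -> i != j -> exists2 h, H h & phi i h != phi j h) ->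
    (forall i h, i \in s -> H h -> [lie h, x i] = phi i h *: x i) ->
    X (\sum_(i <- s) x i) -> forall i, i \in s -> X (x i).
Proof.
move=> sX HX; elim: s x => [//|i s IH] x /= /andP[is_ us] sep hx Xs.
have Xj j : j \in s -> X (x j).
  move=> js; have ij : i != j by apply: contraNneq is_ => ->.
  have [||h Hh phih] := sep i j _ _ ij; [exact: mem_head|by rewrite inE js orbT|].
  have := IH (fun k => (phi k h - phi i h) *: x k) us _ _ _ j js.
  have phi0 : phi j h - phi i h != 0 by rewrite subr_eq0 eq_sym.
  rewrite -{2}[x j](scalerK phi0) => XZ; apply: subspaceZ => //; apply: XZ.
  - by move=> k l ks ls; apply: sep; rewrite inE ?ks ?ls orbT.
  - move=> k h' ks Hh'; rewrite lieZr hx ?inE ?ks ?orbT // !scalerA.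
    by rewrite mulrC.
  have -> : \sum_(k <- s) (phi k h - phi i h) *: x k =
      [lie h, \sum_(k <- i :: s) x k] - phi i h *: (\sum_(k <- i :: s) x k).
    rewrite lie_sumr scaler_sumr !big_cons hx ?mem_head // opprD addrACA subrr add0r.
    rewrite -sumrB big_seq [RHS]big_seq; apply: eq_bigr => k ks.
    by rewrite hx ?inE ?ks ?orbT // -scalerBl.
  by apply: subspaceB => //; [apply: HX|apply: subspaceZ].
move=> j; rewrite inE => /predU1P[->|]; last exact: Xj.
rewrite (_ : x i = \sum_(k <- i :: s) x k - \sum_(k <- s) x k).
  by apply: subspaceB => //; apply: subspace_big => // k ks _; apply: Xj.
by rewrite big_cons addrK.
Qed.

Lemma weight_independent A H : independent_family (weight_space A H).
Proof.
move=> s x us xs x0 i si.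
apply: (@weight_components H [set 0] _ (fun a : dual H => a : L -> F) s) => //.
- exact: subspace_set0.
- by move=> h v _ /= ->; rewrite lie0r.
- by move=> a b _ _; apply: dual_neq.
- by move=> a h sa Hh; have [_ ->] := xs a sa.
Qed.

Lemma weight_subspace A H a : is_subspace A -> is_subspace (weight_space A H a).
Proof.
move=> sA; split.
  by split=> [|h _]; [apply: subspace0|rewrite lie0r scaler0].
move=> c x y [Ax hx] [Ay hy]; split; first exact: sA.2.
by move=> h Hh; rewrite lieDr lieZr hx // hy // scalerDr !scalerA mulrC.
Qed.

Lemma weight_bracket A H a b x y : is_subalgebra A ->
  weight_space A H a x -> weight_space A H b y -> weight_space A H (a + b) [lie x, y].
Proof.
move=> [sA lA] [Ax hx] [Ay hy]; split; first exact: lA.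
by move=> h Hh; rewrite lie_derivation (hx h) // (hy h) // lieZl lieZr -scalerDl.
Qed.

Lemma weight_eq0 A H a b x : a != b ->
  weight_space A H a x -> weight_space A H b x -> x = 0.
Proof.
move=> /dual_neq[h Hh ab] [_ ax] [_ bx]; apply/eqP.
have := ax h Hh; rewrite bx // => /eqP; rewrite -subr_eq0 -scalerBl scaler_eq0.
by rewrite subr_eq0 eq_sym (negPf ab).
Qed.

Lemma centralizer_weight0 A H x : A x -> (forall h, H h -> [lie h, x] = 0) ->
  weight_space A H 0 x.
Proof. by move=> Ax hx; split => // h Hh; rewrite hx // dual0 scale0r. Qed.

Lemma weight0_central A H x h : weight_space A H 0 x -> H h -> [lie h, x] = 0.
Proof. by move=> [_ hx] /hx ->; rewrite dual0 scale0r. Qed.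

(** For s in H with weight components s_a, the element [t, s] of H has
    components a(t) s_a and weight a([t, s]) = 0 for every occurring a, so it is
    central; then a(t)^2 s_a = 0 for all a. *)
Lemma toral_abelian A H t s : is_subalgebra A -> toral A H -> H t -> H s -> [lie t, s] = 0.
Proof.
move=> aA [aH HA _ gen _] Ht Hs.
have sA := aA.1; have ws (a : dual H) := weight_subspace a sA.
have dec x : A x -> exists (r : seq (dual H)) (u : dual H -> L), [/\ uniq r,
    (forall a, weight_space A H a (u a)) & x = \sum_(a <- r) u a].
  move=> Ax; have : subspace_sum setT (weight_space A H) x by rewrite gen.
  by move=> /(subspace_sum_comb ws)[r [u [ur _ uw ->]]]; exists r, u; split.
have tsc x : A x -> [lie [lie t, s], x] = 0.
  move=> /dec[r [u [_ uw ->]]]; rewrite lie_sumr big1 // => a _.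
  rewrite lie_bracketl; have [_ hu] := uw a.
  by rewrite !hu // !lieZr !hu // !scalerA [_ * a t]mulrC subrr.
have [r [u [ur uw sE]]] := dec s (HA s Hs).
have tuE a : [lie t, u a] = (a t : F) *: u a by have [_ ->] := uw a.
have tts : \sum_(a <- r) ((a t : F) * (a t : F)) *: u a = 0.
  have : [lie t, [lie t, s]] = 0 by rewrite lieC tsc ?oppr0 //; apply: HA.
  rewrite sE !lie_sumr => h0; rewrite -[RHS]h0; apply: eq_bigr => a _.
  by rewrite tuE lieZr tuE scalerA.
rewrite sE lie_sumr big_seq big1 // => a ra; rewrite tuE.
have := weight_independent ur _ tts ra => /(_ A) /= h; apply/eqP.
have /eqP : ((a t : F) * (a t : F)) *: u a = 0.
  by apply: h => b _; apply: subspaceZ.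
by rewrite !scaler_eq0 mulf_eq0 orbb.
Qed.

End WeightSpaces.

(** * Integrality and reflection of weights *)
Section Progressions.
Variables (F : fieldType) (V : lmodType F).
Hypothesis char0 : [pchar F] =i pred0.

Lemma finite_no_progression (A : set V) (a b : V) :
  finite_set A -> (forall n : nat, A (b + n%:R *: a)) -> a = 0.
Proof.
move=> fA Ab; apply: contrapT => /eqP a0; apply: infinite_nat.
have -> : [set: nat] = (fun n : nat => b + n%:R *: a) @^-1` A.
  by apply/seteqP; split => n //= _; apply: Ab.
apply: finite_preimage fA => m n _ _ /addrI /eqP.
rewrite -subr_eq0 -scalerBl scaler_eq0 (negPf a0) orbF subr_eq0 => /eqP mn.
wlog le_mn : m n mn / (m <= n)%N.
  by move=> h; case/orP: (leq_total m n) => [/(h m n mn)|/(h n m (esym mn))].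
apply/eqP; rewrite eqn_leq le_mn -subn_eq0 -(natF_eq0 char0) natrB // mn.
by rewrite subrr eqxx.
Qed.

End Progressions.

(** Nonzero vectors of distinct weights are linearly independent. *)
Lemma finite_weights (F : fieldType) (L : lieAlgType F) (A H D : set L) : fin_dim D ->
  finite_set [set a | exists x, [/\ weight_space A H a x, D x & x != 0]].
Proof.
move=> /free_size_bounded[N bnd]; apply: contrapT => /(infinite_set_fset N.+1)[B BD].
apply/negP; rewrite -ltnNge ltnS.
have /choice[v vP] (i : 'I_(size (enum_fset B))) : exists x,
    [/\ weight_space A H (nth 0 (enum_fset B) i) x, D x & x != 0].
  by apply: BD => /=; apply: mem_nth.
apply: (bnd _ v) => [i|u u0]; first by case: (vP i).
apply/rowP => i; rewrite mxE.
pose I := index_enum 'I_(size (enum_fset B)).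
have [_ _ vi0] := vP i; apply/eqP; move: vi0; apply: contraNT => ui0.
have : [set (0 : L)] (u 0 i *: v i); last first.
  by move=> /eqP; rewrite scaler_eq0 (negPf ui0).
apply: (@weight_components _ _ H [set 0] _
  (fun k : 'I__ => (nth 0 (enum_fset B) k : dual H) : L -> F) I (fun k => u 0 k *: v k)).
- exact: subspace_set0.
- by move=> h w _ /= ->; rewrite lie0r.
- exact: index_enum_uniq.
- move=> k l _ _ kl; apply: dual_neq; rewrite nth_uniq //; exact: fset_uniq.
- move=> k h _ Hh; rewrite lieZr; have [[_ ->] // _ _] := vP k.
  by rewrite !scalerA mulrC.
- by [].
- exact: mem_index_enum.
Qed.

Section Admissible.
Variables (F : fieldType) (L : lieAlgType F) (H : set L).
Hypothesis char0 : [pchar F] =i pred0.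
Hypothesis Llf : locally_finite_lie [set: L].
Hypothesis adm : admissible [set: L] H.

Local Notation R := (root_system [set: L] H).
Local Notation wt := (weight_space [set: L] H).

Lemma subalgebra_setT : is_subalgebra [set: L].
Proof. by split. Qed.

Lemma H_subalgebra : is_subalgebra H.
Proof. by case: adm => -[]. Qed.

Lemma H_subspace : is_subspace H.
Proof. exact: H_subalgebra.1. Qed.

Lemma H_abelian t s : H t -> H s -> [lie t, s] = 0.
Proof. by apply: (toral_abelian subalgebra_setT); case: adm. Qed.

Lemma wt_subspace (a : dual H) : is_subspace (wt a).
Proof. exact: weight_subspace. Qed.

Lemma wt_bracket (a b : dual H) x y : wt a x -> wt b y -> wt (a + b) [lie x, y].
Proof. exact: weight_bracket subalgebra_setT. Qed.

Lemma H_wt0 h : H h -> wt 0 h.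
Proof. by move=> Hh; apply: centralizer_weight0 => // t Ht; apply: H_abelian. Qed.

Lemma wtE (a : dual H) x h : wt a x -> H h -> [lie h, x] = (a h : F) *: x.
Proof. by case=> _; apply. Qed.

Lemma wt_dec x : exists (s : seq (dual H)) (u : dual H -> L),
  [/\ uniq s, (forall a, wt a (u a)) & x = \sum_(a <- s) u a].
Proof.
have [[_ _ _ gen _] _ _] := adm.
have : subspace_sum setT wt x by rewrite gen.
by move=> /(subspace_sum_comb wt_subspace)[s [u [us _ uw ->]]]; exists s, u.
Qed.

Lemma wt_nonroot (a : dual H) x : wt a x -> a != 0 -> ~ R a -> x = 0.
Proof.
move=> ax a0 nRa; apply: contrapT => /eqP x0; apply: nRa; split => //.
by exists x.
Qed.

Lemma root_neq0 (a : dual H) : R a -> a != 0.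
Proof. by case. Qed.

(** When x is nonzero, the middle term [x, y] realizes the coroot of a in H. *)
Definition triple (a : dual H) (x y : L) : Prop :=
  [/\ wt a x, wt (- a) y, H [lie x, y] & sl2 x [lie x, y] y].

Lemma ex_triple (a : dual H) x : R a -> wt a x -> x != 0 -> exists y, triple a x y.
Proof.
move=> Ra ax x0; have [_ _ /(_ a x Ra ax x0)[y [ay Hh hx hy]]] := adm.
by exists y.
Qed.

Lemma triple_ev (a : dual H) x y : triple a x y -> x != 0 -> a [lie x, y] = 2.
Proof.
move=> [ax _ Hh [hx _ _]] x0; have := wtE ax Hh; rewrite hx => /eqP.
by rewrite -subr_eq0 -scalerBl scaler_eq0 (negPf x0) orbF subr_eq0 => /eqP.
Qed.

Lemma triple_swap (a : dual H) x y : triple a x y -> triple (- a) y x.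
Proof.
move=> [ax ay Hh t]; split; rewrite ?opprK //.
  by rewrite lieC; apply: subspaceN => //; apply: H_subspace.
by have := sl2_swap t; rewrite -lieC.
Qed.

Lemma triple_swap_neq0 (a : dual H) x y : triple a x y -> x != 0 -> y != 0.
Proof.
move=> t x0; have := triple_ev t x0; apply: contra_eq_neq => ->.
by rewrite lie0r (dual_at0 a H_subspace) eq_sym (natF_eq0 char0 2).
Qed.

Lemma generated_subalgebra (X : set L) : is_subalgebra (smallest (@is_subalgebra F L) X).
Proof.
have sm : is_subspace (smallest (@is_subalgebra F L) X).
  split=> [M [[[]]]//|c x y hx hy M [[sM lM] XM]]; case: (sM) => _; apply.
    by apply: hx; split.
  by apply: hy; split.
split=> // x y hx hy M [[sM lM] XM]; apply: (lM); first by apply: hx; split.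
by apply: hy; split.
Qed.

Lemma generated_incl (X : set L) : X `<=` smallest (@is_subalgebra F L) X.
Proof. exact: sub_gen_smallest. Qed.

Lemma generated_fin_dim (s : seq L) : fin_dim (smallest (@is_subalgebra F L) [set` s]).
Proof. by apply: Llf => //; apply/finite_seqP; exists s. Qed.

Lemma iter_lie_wt (a b : dual H) x u n : wt a x -> wt b u ->
  wt (b + n%:R *: a) (iter n (lie x) u).
Proof.
move=> ax bu; elim: n => [|n IH] /=; first by rewrite scale0r addr0.
rewrite -natr1 scalerDl scale1r addrA addrC; exact: wt_bracket.
Qed.

Lemma iter_lie_closed (G : set L) x u n : (forall v, G v -> G [lie x, v]) -> G u ->
  G (iter n (lie x) u).
Proof. by move=> Gx Gu; elim: n => //= n; apply: Gx. Qed.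

(** The iterates lie in the finite dimensional subalgebra generated by x and u,
    and their weights b + n a are pairwise distinct. *)
Lemma ad_root_nilpotent_wt (a b : dual H) x u : a != 0 -> wt a x -> wt b u ->
  exists n, iter n (lie x) u = 0.
Proof.
move=> a0 ax bu; apply: contrapT => nil.
have fG := generated_fin_dim [:: x; u].
set G := smallest _ _ in fG; have [_ lG] : is_subalgebra G by apply: generated_subalgebra.
have Gx : G x by apply: generated_incl => /=; rewrite inE eqxx.
have Gu : G u by apply: generated_incl => /=; rewrite !inE eqxx orbT.
have := finite_no_progression char0 (b := b) (finite_weights [set: L] H fG) => /(_ a) an0.
move/eqP: a0; apply; apply: an0 => n; exists (iter n (lie x) u); split.
- exact: iter_lie_wt.
- by apply: (iter_lie_closed (G := G)) => // v Gv; apply: lG.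
- by apply/eqP => xn; apply: nil; exists n.
Qed.

Lemma ad_root_nilpotent (a : dual H) x u : a != 0 -> wt a x ->
  exists n, iter n (lie x) u = 0.
Proof.
move=> a0 ax; have [s [v [us vw ->]]] := wt_dec u.
have iterDr n u1 u2 : iter n (lie x) (u1 + u2) = iter n (lie x) u1 + iter n (lie x) u2.
  by elim: n => //= n ->; rewrite lieDr.
elim: s {us} => [|b s [m IH]]; first by exists 0%N; rewrite big_nil.
have [n hn] := ad_root_nilpotent_wt a0 ax (vw b).
exists (m + n)%N; rewrite big_cons iterDr {1}iterD hn iter_lie0 add0r.
by rewrite addnC iterD IH iter_lie0.
Qed.

Lemma weight_integral (a b : dual H) x y v : triple a x y -> x != 0 ->
  wt b v -> v != 0 -> exists n : int, b [lie x, y] = n%:~R.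
Proof.
move=> t x0 bv v0; have [ax ay Hh st] := t.
have a0 : a != 0.
  apply/eqP => a0; have := triple_ev t x0; rewrite a0 dual0 => /esym/eqP.
  by rewrite (natF_eq0 char0 2).
have na0 : - a != 0 by rewrite oppr_eq0.
have [m xm] := ad_root_nilpotent v a0 ax.
apply: (sl2_weight_integral char0 st v0 (wtE bv Hh) xm) => u.
exact: ad_root_nilpotent na0 ay.
Qed.

(** The vector w is a power of ad x or ad y applied to v. The last clause keeps
    track of this, to follow w in subalgebras and in sums of eigenspaces. *)
Lemma weight_reflection (a b : dual H) x y v : triple a x y -> x != 0 ->
  wt b v -> v != 0 ->
  exists w, [/\ wt (b - (b [lie x, y] : F) *: a) w, w != 0 &
    forall G : set L, G v -> (forall u, G u -> G [lie x, u]) ->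
      (forall u, G u -> G [lie y, u]) -> G w].
Proof.
move=> t x0 bv v0; have [ax ay Hh st] := t.
have a0 : a != 0.
  apply/eqP => a0; have := triple_ev t x0; rewrite a0 dual0 => /esym/eqP.
  by rewrite (natF_eq0 char0 2).
have na0 : - a != 0 by rewrite oppr_eq0.
have [n bn] := weight_integral t x0 bv v0.
have hv := wtE bv Hh; case: n bn => [n|n] bn.
  exists (iter n (lie y) v); split.
  - have := iter_lie_wt n ay bv; by rewrite bn scalerN -pmulrn.
  - have [m xm] := ad_root_nilpotent v a0 ax.
    apply: (sl2_lower_neq0 char0 st v0 _ xm).
    by rewrite hv bn -pmulrn.
  - by move=> G Gv Gx Gy; apply: (iter_lie_closed (G := G)).
exists (iter n.+1 (lie x) v); split.
- have := iter_lie_wt n.+1 ax bv; rewrite bn NegzE rmorphN /= scaleNr opprK.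
  by rewrite -pmulrn.
- have [m ym] := ad_root_nilpotent v na0 ay.
  apply: (sl2_lower_neq0 char0 (sl2_swap st) v0 _ ym).
  by rewrite lieNl hv bn NegzE rmorphN /= scaleNr opprK -pmulrn.
- by move=> G Gv Gx Gy; apply: (iter_lie_closed (G := G)).
Qed.

End Admissible.

(** * Forms on coroots given by finite sets of weights *)
Section IntegralForms.
Variables (F : fieldType) (V : lmodType F) (A : set V).
Hypothesis char0 : [pchar F] =i pred0.
Implicit Types (a b : dual A) (P : seq (dual A)).

Lemma intF_inj : injective (fun n : int => n%:~R : F).
Proof.
have inj0 (n : int) : n%:~R = 0 :> F -> n = 0.
  case: n => n; first by rewrite -pmulrn => /eqP; rewrite natF_eq0 // => /eqP->.
  by rewrite NegzE rmorphN /= -pmulrn => /eqP; rewrite oppr_eq0 natF_eq0.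
by move=> m n /eqP; rewrite -subr_eq0 -rmorphB => /eqP /inj0 /eqP; rewrite subr_eq0 => /eqP.
Qed.

(** The substitution of s_a b for b negates b(h) and shifts u by - b(h) u(a),
    so the sum of b(h) u(b) is equal to its opposite plus u(a) times the sum of
    the squares. *)
Lemma reflection_sum P (h : V) (u : dual A -> F) a :
    uniq P -> a h = 2 -> (forall b, b \in P -> b - (b h : F) *: a \in P) ->
    (forall b, b \in P -> u (b - (b h : F) *: a) = u b - (b h : F) * u a) ->
  2 * (\sum_(b <- P) (b h : F) * u b) = u a * \sum_(b <- P) (b h : F) ^+ 2.
Proof.
move=> uP ah sP us; pose s (b : dual A) : dual A := b - (b h : F) *: a.
have sh b : s b h = - b h by rewrite dualB dualZ ah; ring.
have ss : involutive s by move=> b; rewrite {1}/s sh scaleNr opprK subrK.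
have perm_sP : perm_eq (map s P) P.
  have sub : {subset map s P <= P} by move=> _ /mapP[b /sP Pb ->].
  have um : uniq (map s P) by rewrite map_inj_uniq //; apply: inv_inj.
  apply: uniq_perm => //; by apply: (uniq_min_size um sub _).2; rewrite size_map.
set B := \sum_(b <- P) _ * u b; set N := \sum_(b <- P) _.
suff BE : B = u a * N - B by rewrite mulr_natl mulr2n {1}BE subrK.
rewrite {1}/B -(perm_big _ perm_sP) big_map /= mulr_sumr -sumrB.
rewrite big_seq [RHS]big_seq; apply: eq_bigr => b Pb.
have /= -> := sh b; rewrite us //; ring.
Qed.

Lemma sum_squares_neq0 P (h : V) a :
    a \in P -> a h = 2 -> (forall b, b \in P -> exists n : int, b h = n%:~R) ->
  \sum_(b <- P) (b h : F) ^+ 2 != 0.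
Proof.
move=> Pa ah hz; have /choice[n nP] b : exists n : int, b \in P -> b h = n%:~R.
  by case: (boolP (b \in P)) => [/hz[n]|_]; [exists n|exists 0].
rewrite big_seq (eq_bigr (fun b => (n b ^+ 2)%:~R)) => [|b Pb]; last first.
  by rewrite nP // rmorphXn.
rewrite -rmorph_sum -[0 : F]/(0%:~R) (inj_eq intF_inj) -big_seq.
have pos b : 0 <= n b ^+ 2 by apply: sqr_ge0.
rewrite psumr_eq0 //; apply/allPn; exists a => //=; rewrite sqrf_eq0.
by apply/eqP => n0; have := nP a Pa; rewrite n0 ah => /eqP; rewrite (natF_eq0 char0 2).
Qed.

Lemma sum_squares_eq0 P (u : dual A -> F) :
    (forall b, b \in P -> exists n : int, u b = n%:~R) ->
    \sum_(b <- P) u b ^+ 2 = 0 -> forall b, b \in P -> u b = 0.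
Proof.
move=> hz; have /choice[n nP] b : exists n : int, b \in P -> u b = n%:~R.
  by case: (boolP (b \in P)) => [/hz[n]|_]; [exists n|exists 0].
rewrite big_seq (eq_bigr (fun b => (n b ^+ 2)%:~R)) => [|b Pb]; last first.
  by rewrite nP // rmorphXn.
rewrite -rmorph_sum -[0 : F]/(0%:~R) -big_seq => /intF_inj /eqP.
rewrite psumr_eq0 => [/allP h b Pb|b _]; last exact: sqr_ge0.
by have := h b Pb; rewrite /= sqrf_eq0 nP // => /eqP->.
Qed.

Lemma int_Cauchy_Schwarz (I : Type) (P : seq I) (f g : I -> int) :
  0 < \sum_(i <- P) g i ^+ 2 ->
  (\sum_(i <- P) f i * g i) ^+ 2 <= (\sum_(i <- P) f i ^+ 2) * (\sum_(i <- P) g i ^+ 2).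
Proof.
set B := \sum_(i <- P) f i * g i; set M := \sum_(i <- P) f i ^+ 2.
set N := \sum_(i <- P) g i ^+ 2 => N0.
rewrite -subr_ge0 -(pmulr_rge0 _ N0).
have -> : N * (M * N - B ^+ 2) = \sum_(i <- P) (N * f i - B * g i) ^+ 2.
  transitivity (\sum_(i <- P) (N ^+ 2 * f i ^+ 2 - 2 * N * B * (f i * g i) + B ^+ 2 * g i ^+ 2)).
    by rewrite big_split sumrB -!mulr_sumr -/B -/M -/N /=; ring.
  by apply: eq_bigr => i _; ring.
by apply: sumr_ge0 => i _; apply: sqr_ge0.
Qed.

End IntegralForms.

Section RootForms.
Variables (F : fieldType) (L : lieAlgType F) (H : set L).
Hypothesis char0 : [pchar F] =i pred0.
Hypothesis Llf : locally_finite_lie [set: L].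
Hypothesis adm : admissible [set: L] H.

Local Notation R := (root_system [set: L] H).
Local Notation wt := (weight_space [set: L] H).

(** A choice for each root; the values of roots on the resulting coroots do not
    depend on it, by [triple_corootE]. *)
Definition root_vectors (a : dual H) : L * L :=
  xget (0, 0) [set p : L * L | triple a p.1 p.2 /\ p.1 != 0].

Definition coroot_elt (a : dual H) : L := [lie (root_vectors a).1, (root_vectors a).2].

Lemma root_vectorsP (a : dual H) : R a ->
  triple a (root_vectors a).1 (root_vectors a).2 /\ (root_vectors a).1 != 0.
Proof.
move=> Ra; apply: (@xgetPex _ (0, 0) [set p : L * L | triple a p.1 p.2 /\ p.1 != 0]).
have [_ [x ax x0]] := Ra; have [y t] := ex_triple adm Ra ax x0.
by exists (x, y).
Qed.

Lemma coroot_elt_H (a : dual H) : R a -> H (coroot_elt a).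
Proof. by move=> /root_vectorsP[[]]. Qed.

Lemma coroot_elt_diag (a : dual H) : R a -> a (coroot_elt a) = 2.
Proof. by move=> /root_vectorsP[/triple_ev]; apply. Qed.

Lemma root_coroot_int (a b : dual H) : R a -> R b -> exists n : int, b (coroot_elt a) = n%:~R.
Proof.
move=> /root_vectorsP[t x0] [_ [v bv v0]].
exact: (weight_integral char0 Llf adm t x0 bv v0).
Qed.

Lemma triple_reflection (a b : dual H) x y : triple a x y -> x != 0 -> R b ->
  R (b - (b [lie x, y] : F) *: a).
Proof.
move=> t x0 [b0 [v bv v0]].
have [w [sw w0 _]] := weight_reflection char0 Llf adm t x0 bv v0.
split; last by exists w.
apply: contra_neq b0 => sb0.
have : (b - (b [lie x, y] : F) *: a) [lie x, y] = 0 by rewrite sb0 dual0.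
rewrite dualB dualZ (triple_ev t x0) // => /eqP.
have -> : b [lie x, y] - b [lie x, y] * 2 = - b [lie x, y] by ring.
rewrite oppr_eq0 => /eqP ba; by move: sb0; rewrite ba scale0r subr0.
Qed.

Lemma root_reflection (a b : dual H) : R a -> R b -> R (b - (b (coroot_elt a) : F) *: a).
Proof. by move=> /root_vectorsP[]; apply: triple_reflection. Qed.

Lemma root_opp (a : dual H) : R a -> R (- a).
Proof.
move=> Ra; have := root_reflection Ra Ra; rewrite coroot_elt_diag //.
by rewrite scaler_nat mulr2n opprD addrA subrr add0r.
Qed.

(** The weights of the finite dimensional subalgebra generated by the chosen
    sl_2-triples of the roots in T: summing over them gives a form on coroots that
    plays the role of the Killing form. *)
Lemma ex_finite_weights (T : seq (dual H)) : (forall a, a \in T -> R a) ->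
  exists P : seq (dual H), [/\ uniq P, {subset T <= P},
    (forall a b, a \in T -> b \in P -> exists n : int, b (coroot_elt a) = n%:~R) &
    (forall a b, a \in T -> b \in P -> b - (b (coroot_elt a) : F) *: a \in P)].
Proof.
move=> TR; pose X := [seq (root_vectors a).1 | a <- T] ++ [seq (root_vectors a).2 | a <- T].
have fG := generated_fin_dim Llf X; set G := smallest _ _ in fG.
have [_ lG] : is_subalgebra G by apply: generated_subalgebra.
have Gx a : a \in T -> G (root_vectors a).1.
  by move=> Ta; apply: generated_incl; rewrite /= mem_cat; apply/orP; left; apply/mapP; exists a.
have Gy a : a \in T -> G (root_vectors a).2.
  by move=> Ta; apply: generated_incl; rewrite /= mem_cat; apply/orP; right; apply/mapP; exists a.
have /finite_seqP[P0 PE] := finite_weights [set: L] H fG.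
have PP b : reflect (exists x, [/\ wt b x, G x & x != 0]) (b \in undup P0).
  rewrite mem_undup; apply: (iffP idP) => [Pb|hb].
    by have : [set` P0] b by []; rewrite -PE.
  by have : [set` P0] b by rewrite -PE.
exists (undup P0); split.
- exact: undup_uniq.
- move=> a Ta; apply/PP; exists (root_vectors a).1.
  by have [[ax _ _ _] x0] := root_vectorsP (TR a Ta); split => //; apply: Gx.
- move=> a b Ta /PP[v [bv Gv v0]]; have [t x0] := root_vectorsP (TR a Ta).
  exact: (weight_integral char0 Llf adm t x0 bv v0).
- move=> a b Ta /PP[v [bv Gv v0]]; have [t x0] := root_vectorsP (TR a Ta).
  have [w [sw w0 Gw]] := weight_reflection char0 Llf adm t x0 bv v0.
  apply/PP; exists w; split => //; apply: Gw => // u Gu; apply: lG => //.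
    exact: Gx.
  exact: Gy.
Qed.

Lemma form_coroot (T P : seq (dual H)) (a : dual H) (h : L) :
    (forall a, a \in T -> R a) -> uniq P ->
    (forall a b, a \in T -> b \in P -> b - (b (coroot_elt a) : F) *: a \in P) -> a \in T ->
  2 * (\sum_(b <- P) (b (coroot_elt a) : F) * b h) = a h * \sum_(b <- P) (b (coroot_elt a) : F) ^+ 2.
Proof.
move=> TR uP sP Ta; apply: (reflection_sum (u := fun b : dual H => b h)) => //.
- exact/coroot_elt_diag/TR.
- by move=> b; apply: sP.
Qed.

(** Both 2 (h_a, h_c) = a(h_c) N_a and 2 (h_a, h_c) = c(h_a) N_c, with N_a and
    N_c positive, so the two numbers have the same sign, and their product is at
    most 4 by the Cauchy-Schwarz inequality. *)
Lemma cartan_integers (a c : dual H) : R a -> R c -> exists m n : int,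
  [/\ c (coroot_elt a) = m%:~R, a (coroot_elt c) = n%:~R, `|m| <= 4 & (m == 0) = (n == 0)].
Proof.
move=> Ra Rc; pose T := [:: a; c].
have TR b : b \in T -> R b by rewrite !inE => /orP[]/eqP->.
have [P [uP TP Pz sP]] := ex_finite_weights TR.
have [Ta Tc] : a \in T /\ c \in T by rewrite !inE !eqxx orbT.
have /choice[f fE] b : exists n : int, b \in P -> b (coroot_elt a) = n%:~R.
  by case: (boolP (b \in P)) => [/(Pz a b Ta)[n]|_]; [exists n|exists 0].
have /choice[g gE] b : exists n : int, b \in P -> b (coroot_elt c) = n%:~R.
  by case: (boolP (b \in P)) => [/(Pz c b Tc)[n]|_]; [exists n|exists 0].
have [Pa Pc] := (TP a Ta, TP c Tc).
exists (f c), (g a); rewrite fE // gE //.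
pose M := \sum_(b <- P) f b ^+ 2; pose N := \sum_(b <- P) g b ^+ 2.
pose B := \sum_(b <- P) f b * g b.
have sumE (k l : dual H -> int) (p q : dual H -> F) :
    (forall b, b \in P -> p b = (k b)%:~R) -> (forall b, b \in P -> q b = (l b)%:~R) ->
    \sum_(b <- P) p b * q b = (\sum_(b <- P) k b * l b)%:~R.
  move=> pk ql; rewrite rmorph_sum /= !big_seq; apply: eq_bigr => b Pb.
  by rewrite pk // ql // rmorphM.
have E1 : 2 * B = g a * M.
  apply: (@intF_inj F char0); rewrite /= !intrM -(sumE _ _ _ _ fE gE) -gE //.
  by rewrite -(sumE _ _ _ _ fE fE); apply: (form_coroot _ TR).
have E2 : 2 * B = f c * N.
  apply: (@intF_inj F char0); rewrite /= !intrM -(sumE _ _ _ _ fE gE) -fE //.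
  rewrite -(sumE _ _ _ _ gE gE) (eq_bigr (fun b : dual H => b (coroot_elt c) * b (coroot_elt a))).
    exact: (form_coroot _ TR).
  by move=> b _; rewrite mulrC.
have pos (k : dual H -> int) b : b \in P -> k b != 0 -> 0 < \sum_(b <- P) k b ^+ 2.
  move=> Pb kb; rewrite lt_def sumr_ge0 ?andbT => [|i _]; last exact: sqr_ge0.
  rewrite psumr_eq0 => [|i _]; last exact: sqr_ge0.
  by apply/allPn; exists b => //=; rewrite sqrf_eq0.
have two (k : dual H -> int) (b : dual H) : b (coroot_elt b) = (k b)%:~R -> R b -> k b != 0.
  move=> kb Rb; apply/eqP => k0; move: kb; rewrite k0 coroot_elt_diag // => /eqP.
  by rewrite (natF_eq0 char0 2).
have M0 : 0 < M by apply: (pos f a Pa); apply: (two f a) => //; apply: fE.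
have N0 : 0 < N by apply: (pos g c Pc); apply: (two g c) => //; apply: gE.
have CS : B ^+ 2 <= M * N by apply: int_Cauchy_Schwarz.
split => //; last first.
  by rewrite -(inj_eq (mulIf (lt0r_neq0 N0))) mul0r -E2 E1 mulf_eq0 (gt_eqF M0) orbF.
clearbody B M N; clear - E1 E2 CS M0 N0.
have pq : f c * g a <= 4.
  rewrite -(ler_pM2r (mulr_gt0 M0 N0)).
  have -> : f c * g a * (M * N) = 4 * B ^+ 2.
    have -> : f c * g a * (M * N) = (f c * N) * (g a * M) by ring.
    by rewrite -E1 -E2; ring.
  by rewrite ler_pM2l.
have [->|p0] := eqVneq (f c) 0; first by rewrite normr0.
have : 0 < f c * g a.
  have : 0 < (f c * N) * (f c * N) by rewrite -expr2 exprn_even_gt0 //= mulf_neq0 // lt0r_neq0.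
  rewrite -{2}E2 E1 (_ : _ * _ = f c * g a * (M * N)); last by ring.
  by rewrite pmulr_lgt0 // mulr_gt0.
move: pq; move: (f c) (g a) => p q; clear => h1 h2.
rewrite ler_norml; case: (ltrgtP q 0) h1 h2 => [q0|q0|->]; last by rewrite mulr0.
  by move=> h1 h2; apply/andP; split; nia.
by move=> h1 h2; apply/andP; split; nia.
Qed.

(** The element u = N_c h_a - N_a h_c of H is orthogonal to h_t for t in T, so
    it is killed by T, by its span, and by a and c; hence (u, u) = 0, and u is
    killed by all the weights of the form, because it takes integral values on
    them. But (u, h) is proportional to (a - c)(h). *)
Lemma root_determined (T : seq (dual H)) (a c : dual H) :
    (forall t, t \in T -> R t) -> R a -> R c ->
    lin_span [set` T] a -> lin_span [set` T] c ->
    (forall t, t \in T -> a (coroot_elt t) = c (coroot_elt t)) -> a = c.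
Proof.
move=> TR Ra Rc Ta Tc ac; pose T' := a :: c :: T.
have T'R b : b \in T' -> R b by rewrite !inE => /orP[/eqP->|/orP[/eqP->|/TR]].
have [P [uP T'P Pz sP]] := ex_finite_weights T'R.
have T'a : a \in T' by rewrite inE eqxx.
have T'c : c \in T' by rewrite !inE eqxx orbT.
have form := form_coroot _ T'R uP sP.
pose N b := \sum_(d <- P) (d (coroot_elt b) : F) ^+ 2.
have Nn0 b : b \in T' -> N b != 0.
  move=> T'b; apply: (sum_squares_neq0 char0 (T'P b T'b)); first exact/coroot_elt_diag/T'R.
  by move=> d; apply: Pz.
pose u (b : dual H) : F := N c * b (coroot_elt a) - N a * b (coroot_elt c).
have uh h : 2 * (\sum_(b <- P) u b * b h) = N a * N c * (a h - c h).
  have -> : \sum_(b <- P) u b * b h = N c * (\sum_(b <- P) (b (coroot_elt a) : F) * b h)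
      - N a * (\sum_(b <- P) (b (coroot_elt c) : F) * b h).
    by rewrite !mulr_sumr -sumrB; apply: eq_bigr => b _; rewrite /u; ring.
  rewrite mulrBr mulrCA form // [2 * (N a * _)]mulrCA form // -/(N a) -/(N c).
  by ring.
have uT t : t \in T -> u t = 0.
  move=> Tt; have T't : t \in T' by rewrite !inE Tt !orbT.
  have us b : b \in P -> u (b - (b (coroot_elt t) : F) *: t) = u b - (b (coroot_elt t) : F) * u t.
    by move=> _; rewrite /u !dualB !dualZ; ring.
  have := reflection_sum uP (coroot_elt_diag (T'R _ T't)) (fun b => sP t b T't) us.
  rewrite -/(N t) (eq_bigr (fun b => u b * b (coroot_elt t))) => [|b _]; last by rewrite mulrC.
  rewrite uh ac // subrr mulr0 => /esym/eqP.
  by rewrite mulf_eq0 (negPf (Nn0 t T't)) orbF => /eqP.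
have u_span : lin_span [set` T] `<=` [set b | u b = 0].
  apply: span_min => //; split; first by rewrite /= /u !dual0 !mulr0 subrr.
  move=> k x y /= ux uy; have -> : u (k *: x + y) = k * u x + u y.
    by rewrite /u !dualD !dualZ; ring.
  by rewrite ux uy mulr0 addr0.
have uu : \sum_(b <- P) u b ^+ 2 = 0.
  have two0 : (2 : F) != 0 by rewrite (natF_eq0 char0 2).
  apply: (mulfI two0); rewrite mulr0.
  have -> : \sum_(b <- P) u b ^+ 2 = N c * (\sum_(b <- P) u b * b (coroot_elt a))
      - N a * (\sum_(b <- P) u b * b (coroot_elt c)).
    by rewrite !mulr_sumr -sumrB; apply: eq_bigr => b _; rewrite expr2 {1}/u; ring.
  rewrite mulrBr mulrCA uh [2 * (N a * _)]mulrCA uh.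
  have := u_span a Ta; have := u_span c Tc; rewrite /= /u => uc0 ua0.
  transitivity (N a * N c * ((N c * a (coroot_elt a) - N a * a (coroot_elt c)) - (N c * c (coroot_elt a) - N a * c (coroot_elt c)))).
    by ring.
  by rewrite ua0 uc0 subrr mulr0.
have u0 : forall b, b \in P -> u b = 0.
  apply: (sum_squares_eq0 char0) uu => b Pb.
  have sq d : d \in T' -> exists n : int, N d = n%:~R.
    move=> T'd; have /choice[n nP] e : exists n : int, e \in P -> e (coroot_elt d) = n%:~R.
      by case: (boolP (e \in P)) => [/(Pz d e T'd)[n]|_]; [exists n|exists 0].
    exists (\sum_(e <- P) n e ^+ 2); rewrite rmorph_sum /= /N !big_seq.
    by apply: eq_bigr => e Pe; rewrite nP // rmorphXn.
  have [[k kE] [l lE]] := (sq c T'c, sq a T'a).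
  have [[m mE] [n nE]] := (Pz a b T'a Pb, Pz c b T'c Pb).
  by exists (k * m - l * n); rewrite rmorphB !rmorphM /= /u kE lE mE nE.
apply: dual_eq => h _; apply/eqP; rewrite -subr_eq0.
have /eqP := uh h; rewrite big_seq big1 ?mulr0 => [|b Pb]; last by rewrite u0 ?mul0r.
by rewrite eq_sym !mulf_eq0 (negPf (Nn0 a T'a)) (negPf (Nn0 c T'c)).
Qed.

End RootForms.

(** * The locally finite root system *)
Lemma absz_shift_lt (p : int) : `|p| <= 4 -> (absz (p + 4)%R < 9)%N.
Proof. lia. Qed.

Lemma absz_shift_inj (p q : int) : `|p| <= 4 -> `|q| <= 4 ->
  absz (p + 4) = absz (q + 4) -> p = q.
Proof. lia. Qed.

Section RootSystem.
Variables (F : fieldType) (L : lieAlgType F) (H : set L).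
Hypothesis char0 : [pchar F] =i pred0.
Hypothesis Llf : locally_finite_lie [set: L].
Hypothesis adm : admissible [set: L] H.

Local Notation R := (root_system [set: L] H).
Local Notation wt := (weight_space [set: L] H).
Local Notation W := (lin_span R).

(** A root of the span is determined by its values on the coroots of T, and these
    are integers between - 4 and 4. *)
Lemma roots_in_span_finite (T : seq (dual H)) : (forall t, t \in T -> R t) ->
  finite_set (R `&` lin_span [set` T]).
Proof.
move=> TR.
have /choice[n nP] (p : dual H * dual H) : exists n : int, R p.1 -> R p.2 ->
    p.1 (coroot_elt p.2) = n%:~R /\ `|n| <= 4.
  have [[R1 R2]|nR] := pselect (R p.1 /\ R p.2); last first.
    by exists 0 => R1 R2; case: nR.
  by have [n [_ [? _ ? _]]] := cartan_integers char0 Llf adm R2 R1; exists n.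
(* The values of a on the coroots of T, shifted from [-4, 4] to [0, 8]. *)
pose code a : {ffun 'I_(size T) -> 'I_9} := [ffun i : 'I_(size T) => inord (absz (n (a, T`_i) + 4))].
have code_inj : {in R `&` lin_span [set` T] &, injective code}.
  move=> a b; rewrite !inE => -[Ra Ta] [Rb Tb] /ffunP ab.
  apply: (root_determined char0 Llf adm TR Ra Rb Ta Tb) => t Tt.
  have Rt := TR t Tt.
  have [[-> na] [-> nb]] := (nP (a, t) Ra Rt, nP (b, t) Rb Rt).
  have := ab (Ordinal (etrans (index_mem t T) Tt)); rewrite !ffunE /= nth_index //.
  move=> /(congr1 val); rewrite /= !inordK; try exact: absz_shift_lt.
  by move=> h; congr (_%:~R); apply: absz_shift_inj h.
have := inj_card_eq code_inj => /eq_finite_set <-; exact: finite_finset.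
Qed.

Lemma root_W (a : dual H) : R a -> W a.
Proof. exact: span_incl. Qed.

Lemma triple_is_coroot (a : dual H) x y : R a -> triple a x y -> x != 0 ->
  is_coroot R a (ev_dual W [lie x, y]).
Proof.
move=> Ra t x0; split; first by rewrite ev_dualE ?(triple_ev t x0) //; apply: root_W.
move=> b Rb; rewrite /reflection ev_dualE; last exact: root_W.
exact: (triple_reflection char0 Llf adm t x0 Rb).
Qed.

(** If f and g are coroots of a, then s_g s_f b = b + (f b - g b) a; iterating,
    the progression b + n (f b - g b) a stays in a finite set of roots. *)
Lemma coroot_unique (a b : dual H) (f g : dual W) : R a -> R b ->
  is_coroot R a f -> is_coroot R a g -> f b = g b.
Proof.
move=> Ra Rb [fa fR] [ga gR]; have Wa := root_W Ra.
have lin (k : dual W) c x y : W x -> W y -> k (c *: x + y) = (c : F) * k x + k y.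
  by move=> Wx Wy; apply: dual_lin => //; apply: span_subspace.
pose c : F := f b - g b.
have prog n : R (b + n%:R *: (c *: a)).
  elim: n => [|n IH]; first by rewrite scale0r addr0.
  pose d : dual H := b + n%:R *: (c *: a); have {}IH : R d by [].
  have Wd := root_W IH.
  have dE : d = (n%:R * c) *: a + b by rewrite /d scalerA addrC.
  have fd : f d = n%:R * c * 2 + f b by rewrite dE lin ?fa //; exact: root_W.
  have gd : g d = n%:R * c * 2 + g b by rewrite dE lin ?ga //; exact: root_W.
  have := gR _ (fR _ IH); rewrite /reflection.
  have -> : g (d - (f d : F) *: a) = - (f d : F) * 2 + g d.
    by rewrite addrC -scaleNr lin // ga.
  have -> : b + n.+1%:R *: (c *: a) = d + c *: a.
    by rewrite /d -natr1 scalerDl scale1r addrA.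
  congr (R _); rewrite -addrA -!scaleNr -scalerDl; congr (_ + _ *: _).
  by rewrite fd gd /c; ring.
have := finite_no_progression char0 (b := b) (roots_in_span_finite (T := [:: a; b]) _).
have ab_R t : t \in [:: a; b] -> R t by rewrite !inE => /orP[]/eqP->.
move=> /(_ (c *: a) ab_R) h.
have /eqP : c *: a = 0.
  apply: h => n; split => //; rewrite addrC; apply: (span_subspace _).2.
    apply: (subspaceZ _ (span_subspace _)); apply: span_incl.
    by rewrite /= inE eqxx.
  by apply: span_incl; rewrite /= !inE eqxx orbT.
by rewrite scaler_eq0 (negPf (root_neq0 Ra)) orbF subr_eq0 => /eqP.
Qed.

Lemma root_is_coroot (a : dual H) : R a -> is_coroot R a (ev_dual W (coroot_elt a)).
Proof. by move=> Ra; have [t x0] := root_vectorsP adm Ra; apply: triple_is_coroot. Qed.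

Lemma coroot_is_coroot (a : dual H) : R a -> is_coroot R a (coroot W R a).
Proof. by move=> Ra; apply: xgetPex; exists (ev_dual W (coroot_elt a)); apply: root_is_coroot. Qed.

Lemma corootE (a b : dual H) : R a -> R b -> coroot W R a b = b (coroot_elt a).
Proof.
move=> Ra Rb.
rewrite (coroot_unique Ra Rb (coroot_is_coroot Ra) (root_is_coroot Ra)).
by rewrite ev_dualE //; apply: root_W.
Qed.

Lemma triple_corootE (a b : dual H) x y : R a -> R b -> triple a x y -> x != 0 ->
  b [lie x, y] = b (coroot_elt a).
Proof.
move=> Ra Rb t x0.
have := coroot_unique Ra Rb (triple_is_coroot Ra t x0) (root_is_coroot Ra).
by rewrite !ev_dualE //; apply: root_W.
Qed.

Lemma coroot_neq0_sym (a b : dual H) : R a -> R b -> b (coroot_elt a) != 0 -> a (coroot_elt b) != 0.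
Proof.
move=> Ra Rb; have [m [n [-> -> _ mn]]] := cartan_integers char0 Llf adm Ra Rb.
by rewrite -[0 : F]/(0%:~R) !(inj_eq (intF_inj char0)) mn.
Qed.

Lemma ex_root : exists a, R a.
Proof.
apply: contrapT => noR; have [[_ _ [h Hh h0] _ _] Hgen _] := adm.
move/negP: h0; apply; apply/eqP.
have : [set (0 : L)] h; last by [].
apply: (span_min _ _ (Hgen h Hh)); first exact: subspace_set0.
by move=> x [a Ra _]; case: noR; exists a.
Qed.

Lemma roots_lf_root_system : lf_root_system W R.
Proof.
split.
- have [a Ra] := ex_root; exists a; [exact: root_W|exact: root_neq0].
- split => //; first by case; rewrite eqxx.
  move=> D sD DW [X /finite_seqP[s ->] DE].
  have [|T [TR sT]] := @span_cover _ _ R s.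
    by move=> x xs; apply: DW; rewrite DE; apply: span_incl.
  apply: sub_finite_set (roots_in_span_finite TR) => a [Ra Da]; split => //.
  by move: Da; rewrite DE; apply: span_min; first exact: span_subspace.
- by move=> a Ra; exists (ev_dual W (coroot_elt a)); apply: root_is_coroot.
- by move=> a b Ra Rb; rewrite corootE //; apply: root_coroot_int.
Qed.

Section Connectedness.
Variable S : set (dual H).
Hypothesis SR : S `<=` R.

Lemma conn_refl (a : dual H) : S a -> connected_in W R S a a.
Proof. by move=> Sa; exists [::]; split => // c; rewrite inE => /eqP->. Qed.

Lemma conn_step (a b : dual H) : S a -> S b -> a (coroot_elt b) != 0 -> connected_in W R S a b.
Proof.
move=> Sa Sb ab; exists [:: b]; split => //=; last by rewrite corootE ?ab //; apply: SR.
by move=> c; rewrite !inE => /orP[]/eqP->.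
Qed.

Lemma conn_trans (a b c : dual H) :
  connected_in W R S a b -> connected_in W R S b c -> connected_in W R S a c.
Proof.
move=> [s [sS ps <-]] [t [tS pt <-]]; exists (s ++ t); split.
- move=> d; rewrite inE mem_cat => /orP[da|/orP[ds|dt]].
  + by apply: sS; rewrite inE da.
  + by apply: sS; rewrite inE ds orbT.
  + by apply: tS; rewrite inE dt orbT.
- by rewrite cat_path ps.
- by rewrite last_cat.
Qed.

Lemma conn_in (a b : dual H) : connected_in W R S a b -> S a /\ S b.
Proof.
by move=> [s [sS _ <-]]; split; apply: sS; [apply: mem_head|apply: mem_last].
Qed.

Lemma conn_sym (a b : dual H) : connected_in W R S a b -> connected_in W R S b a.
Proof.
move=> [s [sS ps <-]]; elim: s a sS ps => [|c s IH] a sS /=.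
  by move=> _; apply: conn_refl; apply: sS; apply: mem_head.
move=> /andP[ac ps]; have Sa : S a by apply: sS; apply: mem_head.
have Sc : S c by apply: sS; rewrite !inE eqxx orbT.
apply: (@conn_trans _ c).
  by apply: IH => // d ds; apply: sS; rewrite inE ds orbT.
apply: conn_step => //; apply: coroot_neq0_sym; try exact: SR.
by move: ac; rewrite corootE //; apply: SR.
Qed.

End Connectedness.
End RootSystem.

(** * Subalgebras spanned by root spaces, and irreducibility *)
Section RootSubalgebras.
Variables (F : fieldType) (L : lieAlgType F) (H : set L).
Hypothesis char0 : [pchar F] =i pred0.
Hypothesis Llf : locally_finite_lie [set: L].
Hypothesis adm : admissible [set: L] H.

Local Notation R := (root_system [set: L] H).
Local Notation wt := (weight_space [set: L] H).
Local Notation W := (lin_span R).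
Local Notation cartan := (cartan_part [set: L] H).
Local Notation LS := (root_subalgebra [set: L] H).

Implicit Types (C S : set (dual H)) (a b c d : dual H).

Lemma cartan_subspace C : is_subspace (cartan C).
Proof. exact: span_subspace. Qed.

Lemma LS_subspace C : is_subspace (LS C).
Proof. exact: span_subspace. Qed.

Lemma cartan_bracket C a x y : C a -> wt a x -> wt (- a) y -> cartan C [lie x, y].
Proof.
move=> Ca ax ay; apply: span_incl; exists a => //; apply: span_incl.
by exists x => //; exists y.
Qed.

Lemma cartan_min C (X : set L) : is_subspace X ->
  (forall a x y, C a -> wt a x -> wt (- a) y -> X [lie x, y]) -> cartan C `<=` X.
Proof.
move=> sX CX; apply: span_min => // z [a Ca]; apply: span_min => // _ [x ax [y ay <-]].
exact: CX ay.
Qed.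

Lemma cartan_LS C : cartan C `<=` LS C.
Proof. by move=> x Cx; apply: span_incl; left. Qed.

Lemma wt_LS C a x : C a -> wt a x -> LS C x.
Proof.
move=> Ca ax; apply: span_incl; right; apply: span_incl; by exists a.
Qed.

Lemma LS_min C (X : set L) : is_subspace X ->
  (forall a x, C a -> wt a x -> X x) ->
  (forall a x y, C a -> wt a x -> wt (- a) y -> X [lie x, y]) -> LS C `<=` X.
Proof.
move=> sX CX CX2; apply: span_min => // z [|]; first exact: cartan_min.
by apply: span_min => // x [a Ca ax]; apply: CX ax.
Qed.

Lemma cartan_wt0 C x : cartan C x -> wt 0 x.
Proof.
apply: cartan_min; first exact: wt_subspace.
by move=> a y z _ ay az; rewrite -(subrr a); apply: wt_bracket.
Qed.

Lemma LS_mono C C' : C `<=` C' -> LS C `<=` LS C'.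
Proof.
move=> CC'; apply: LS_min; first exact: LS_subspace.
  by move=> a x /CC'; apply: wt_LS.
by move=> a x y /CC' C'a ax ay; apply: cartan_LS; apply: (cartan_bracket C'a).
Qed.

Lemma LS_dec C x : LS C x -> exists z (s : seq (dual H)) (u : dual H -> L),
  [/\ cartan C z, uniq s, (forall a, a \in s -> C a), (forall a, wt a (u a)) &
      x = z + \sum_(a <- s) u a].
Proof.
apply: (@span_min _ _ _ [set x | exists z (s : seq (dual H)) (u : dual H -> L),
  [/\ cartan C z, uniq s, (forall a, a \in s -> C a), (forall a, wt a (u a)) &
      x = z + \sum_(a <- s) u a]]).
  split.
    exists 0, [::], (fun _ => 0); split => // [|a|]; last by rewrite big_nil addr0.
      exact: subspace0 (cartan_subspace C).
    exact: subspace0 (wt_subspace a).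
  move=> k _ _ [z [s [u [Cz us sC uw ->]]]] [z' [s' [u' [Cz' us' sC' uw' ->]]]].
  have : root_part [set: L] H C (k *: (\sum_(a <- s) u a) + \sum_(a <- s') u' a).
    have sR : is_subspace (root_part [set: L] H C) by apply: span_subspace.
    apply: sR.2; apply: subspace_big => // a sa _; apply: span_incl.
      by exists a; [apply: sC|apply: uw].
    by exists a; [apply: sC'|apply: uw'].
  move=> /(subspace_sum_comb (@wt_subspace _ _ H))[t [v [ut tC vw E]]].
  exists (k *: z + z'), t, v; split => //; first exact: (cartan_subspace C).2.
  by rewrite -E scalerDr addrACA.
move=> y [Cy|].
  exists y, [::], (fun _ => 0); split => //; last by rewrite big_nil addr0.
  move=> a; exact: subspace0 (wt_subspace a).
move=> /(subspace_sum_comb (@wt_subspace _ _ H))[t [v [ut tC vw E]]].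
exists 0, t, v; split => //; last by rewrite add0r.
exact: subspace0 (cartan_subspace C).
Qed.

(** Only a subset K of H is required to separate weights and to preserve X, so
    that the lemma applies to ideals of subalgebras, which are stable under a part
    of H only. *)
Lemma LS_components (K X : set L) C x : is_subspace X ->
    K `<=` H -> (forall h v, K h -> X v -> X [lie h, v]) ->
    (forall a b, C a \/ a = 0 -> C b \/ b = 0 -> a != b -> exists2 h, K h & a h != b h) ->
    ~ C 0 -> LS C x -> X x ->
  exists z (s : seq (dual H)) (u : dual H -> L),
  [/\ cartan C z, (forall a, a \in s -> C a), (forall a, wt a (u a)) &
      x = z + \sum_(a <- s) u a] /\ X z /\ forall a, a \in s -> X (u a).
Proof.
move=> sX KH KX sep C0 /LS_dec[z [s [u [Cz us sC uw xE]]]] Xx.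
have s0 : 0 \notin s by apply/negP => /sC.
(* The index 0, which is not in C, stands for the component in the Cartan part. *)
pose v a := if a == 0 then z else u a.
have vs a : a \in s -> v a = u a.
  by move=> sa; rewrite /v; case: eqP => // a0; rewrite a0 (negPf s0) in sa.
have xv : x = \sum_(a <- 0 :: s) v a.
  rewrite big_cons xE /v eqxx; congr (_ + _); rewrite !big_seq; apply: eq_bigr => a sa.
  by rewrite -[RHS]/(v a) vs.
have sC0 a : a \in 0 :: s -> C a \/ a = 0.
  by rewrite inE => /predU1P[->|/sC]; [right|left].
have Xv a : a \in 0 :: s -> X (v a).
  apply: (@weight_components _ _ K X _ (fun a : dual H => a : L -> F)) => //.
  - by rewrite /= s0.
  - by move=> b c /sC0 Cb /sC0 Cc; apply: sep.
  - move=> b h _ Kh; have Hh := KH h Kh; rewrite /v; case: eqP => [->|_].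
      exact: wtE (cartan_wt0 Cz) Hh.
    exact: wtE (uw b) Hh.
  - by rewrite -xv.
exists z, s, u; split => //; split; first by have := Xv 0; rewrite /v eqxx; apply; apply: mem_head.
by move=> a sa; rewrite -vs //; apply: Xv; rewrite inE sa orbT.
Qed.

Lemma H_wt_stable b h v : H h -> wt b v -> wt b [lie h, v].
Proof. by move=> Hh bv; rewrite (wtE bv Hh); apply: subspaceZ => //; apply: wt_subspace. Qed.

Lemma LS_wt0 C x : ~ C 0 -> LS C x -> wt 0 x -> cartan C x.
Proof.
move=> C0 Cx x0.
have [z [s [u [[Cz sC uw xE] [_ us]]]]] := LS_components (wt_subspace _)
  (@subset_refl _ H) (@H_wt_stable 0) (fun a b _ _ => @dual_neq _ _ _ a b) C0 Cx x0.
rewrite xE big_seq big1 ?addr0 // => a sa.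
apply: (weight_eq0 (a := 0) (b := a)) (us a sa) (uw a).
by apply: contra_notN C0 => /eqP->; apply: sC.
Qed.

Lemma LS_wt_notin C b x : ~ C 0 -> ~ C b -> b != 0 -> LS C x -> wt b x -> x = 0.
Proof.
move=> C0 Cb b0 Cx bx.
have [z [s [u [[Cz sC uw xE] [bz us]]]]] := LS_components (wt_subspace _)
  (@subset_refl _ H) (@H_wt_stable b) (fun a c _ _ => @dual_neq _ _ _ a c) C0 Cx bx.
have z0 : z = 0 by apply: (weight_eq0 b0 bz (cartan_wt0 Cz)).
rewrite xE z0 add0r big_seq big1 // => a sa.
apply: (weight_eq0 (a := b) (b := a)) (us a sa) (uw a).
by apply: contra_notN Cb => /eqP->; apply: sC.
Qed.

Lemma LS_bracket_wt0 C x v : wt 0 x -> LS C v -> LS C [lie x, v].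
Proof.
move=> x0; have xwt a u : wt a u -> wt a [lie x, u].
  by move=> au; rewrite -[a]add0r; apply: wt_bracket.
apply: (@LS_min C [set v | LS C [lie x, v]]).
- split; first by rewrite /= lie0r; apply: (subspace0 (LS_subspace C)).
  by move=> k u w /= Cu Cw; rewrite lieDr lieZr; exact: ((LS_subspace C).2 _ _ _ Cu Cw).
- by move=> a u Ca au; exact: (wt_LS Ca (xwt _ _ au)).
move=> a u w Ca au aw /=; rewrite lie_derivation; apply: (subspaceD (LS_subspace C)).
  by apply: cartan_LS; apply: (cartan_bracket Ca (xwt _ _ au) aw).
by apply: cartan_LS; apply: (cartan_bracket Ca au (xwt _ _ aw)).
Qed.

(** The alternative serves two purposes: a in C for subalgebras, and a outside C
    for ideals, where x kills the root spaces of C. *)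
Lemma LS_bracket_root C a x v : C `<=` R -> (forall c, C c -> C (- c)) ->
    (forall c, C c -> R (a + c) -> C (a + c)) ->
    (C a \/ forall c, C c -> ~ R (a + c)) ->
  wt a x -> LS C v -> LS C [lie x, v].
Proof.
move=> CR CN Ca_closed Ca ax; apply: (@LS_min C [set v | LS C [lie x, v]]).
- split; first by rewrite /= lie0r; apply: (subspace0 (LS_subspace C)).
  by move=> k u w /= Cu Cw; rewrite lieDr lieZr; exact: ((LS_subspace C).2 _ _ _ Cu Cw).
- move=> b u Cb bu /=; have abxu := wt_bracket ax bu.
  have [ab0|ab0] := eqVneq (a + b) 0.
    have ba : b = - a by apply/eqP; rewrite -addr_eq0 addrC ab0.
    apply: cartan_LS; rewrite lieC; apply: (subspaceN (cartan_subspace C)).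
    by apply: (cartan_bracket Cb bu); rewrite ba opprK.
  have [Rab|nRab] := pselect (R (a + b)).
    by apply: (wt_LS (Ca_closed b Cb Rab)).
  rewrite (wt_nonroot abxu) //; apply: (subspace0 (LS_subspace C)).
move=> b u w Cb bu bw /=.
have axuw : wt a [lie x, [lie u, w]].
  by rewrite -[a]addr0 -(subrr b); do 2 apply: wt_bracket => //.
case: Ca => [Ca|nC]; first exact: (wt_LS Ca).
have nul c y : C c -> wt c y -> a + c != 0 -> [lie x, y] = 0.
  by move=> Cc cy ac0; apply: (wt_nonroot (wt_bracket ax cy)) => //; apply: nC.
have [ab0|ab0] := eqVneq (a + b) 0.
  apply: (wt_LS (a := a)) => //.
  have -> : a = - b by apply/eqP; rewrite -addr_eq0 ab0.
  exact: CN.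
have [ab1|ab1] := eqVneq (a - b) 0.
  apply: (wt_LS (a := a)) => //.
  by have -> : a = b by apply/eqP; rewrite -subr_eq0 ab1.
rewrite lie_derivation (nul b) // lie0l (nul (- b)) //; last exact: CN.
by rewrite lie0r addr0; apply: (subspace0 (LS_subspace C)).
Qed.

(** If C absorbs addition of roots and a is a root outside C, then no a + c with c
    in C is a root, because a = - c + (c + a) would be absorbed too. *)
Lemma absorbing_ideal C : C `<=` R -> (forall c, C c -> C (- c)) ->
    (forall c d, C c -> R d -> R (c + d) -> C (c + d)) ->
  is_ideal [set: L] (LS C).
Proof.
move=> CR CN abs; split => //; first exact: LS_subspace.
move=> x v _ Cv; have [s [u [_ uw ->]]] := wt_dec adm x.
rewrite lie_suml; apply: subspace_big => [|a _ _]; first exact: LS_subspace.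
have [->|x0] := eqVneq (u a) 0.
  by rewrite lie0l; apply: (subspace0 (LS_subspace C)).
have [a0|a0] := eqVneq a 0.
  by apply: LS_bracket_wt0 => //; rewrite -a0.
have Ra : R a by split => //; exists (u a).
apply: (LS_bracket_root CR CN _ _ (uw a) Cv).
  by move=> c Cc; rewrite addrC => Rac; apply: abs.
have [Ca|nCa] := pselect (C a); [by left|right] => c Cc Rac; apply: nCa.
have Cac : C (c + a) by apply: abs => //; rewrite addrC.
have -> : a = - c + (c + a) by rewrite addKr.
by apply: abs => //; [apply: CN|apply: CR|rewrite addKr].
Qed.

(** A nonzero ideal. In particular the zero weight space is spanned by the brackets of opposite
    root vectors. *)
Lemma LS_all_roots : simple_lie [set: L] -> LS R = [set: L].
Proof.
move=> [_ _ simp]; have idl : is_ideal [set: L] (LS R).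
  apply: absorbing_ideal => // a; apply: (root_opp char0 Llf adm).
have [h|->//] := simp (LS R) idl.
have [a [a0 [x ax x0]]] := ex_root adm.
have : LS R x by apply: (wt_LS (a := a)) => //; split => //; exists x.
by rewrite h => /eqP; rewrite (negPf x0).
Qed.

(** If c, d and c + d are roots with c + d orthogonal to both c and d, then
    c(h_d) = d(h_c) = - 2, so c and - d agree on the coroots of c and - d. Otherwise
    c + d is joined to c. Hence a connected component absorbs roots, and spans
    an ideal. *)
Lemma roots_irreducible : simple_lie [set: L] -> irreducible_in W R R.
Proof.
move=> Ls a b Ra Rb; pose C := [set c | connected_in W R R a c].
have CR : C `<=` R by move=> c h; case: (conn_in h).
have coroot_elt_opp c d : R c -> R d -> d (coroot_elt (- c)) = - d (coroot_elt c).
  move=> Rc Rd; have [t x0] := root_vectorsP adm Rc.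
  have y0 := triple_swap_neq0 char0 adm t x0.
  rewrite -(triple_corootE char0 Llf adm (root_opp char0 Llf adm Rc) Rd (triple_swap adm t) y0).
  rewrite lieC -/(coroot_elt c) -scaleN1r dual_scale ?mulN1r //; first exact: H_subspace.
  exact: coroot_elt_H.
have step c d : C c -> R d -> c (coroot_elt d) != 0 -> C d.
  move=> Cc Rd cd; apply: (conn_trans Cc); apply: (conn_step char0 Llf adm) => //.
  exact: CR.
have sym c d : C c -> R d -> d (coroot_elt c) != 0 -> C d.
  move=> Cc Rd cd; apply: (step c) => //.
  by apply: (coroot_neq0_sym char0 Llf adm) => //; apply: CR.
have two0 : (2 : F) != 0 by rewrite (natF_eq0 char0 2).
have CN c : C c -> C (- c).
  move=> Cc; have Rc := CR c Cc; apply: (sym c) => //; first exact: root_opp.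
  by rewrite dualN (coroot_elt_diag adm) // oppr_eq0.
have abs c d : C c -> R d -> R (c + d) -> C (c + d).
  move=> Cc Rd Rcd; have Rc := CR c Cc.
  have [cd0|] := eqVneq ((c + d) (coroot_elt c)) 0; last exact: sym.
  have dc : d (coroot_elt c) = - 2.
    by apply/eqP; rewrite -addr_eq0 addrC -cd0 dualD (coroot_elt_diag adm).
  have Cd : C d by apply: (sym c) => //; rewrite dc oppr_eq0.
  have [dc0|] := eqVneq ((c + d) (coroot_elt d)) 0; last exact: sym.
  have cdm : c (coroot_elt d) = - 2.
    by apply/eqP; rewrite -addr_eq0 -dc0 dualD (coroot_elt_diag adm Rd).
  have RNd := root_opp char0 Llf adm Rd.
  have : c = - d.
    apply: (root_determined char0 Llf adm (T := [:: c; - d])) => //.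
    - by move=> t; rewrite !inE => /orP[]/eqP->.
    - by apply: span_incl; rewrite /= inE eqxx.
    - by apply: span_incl; rewrite /= !inE eqxx orbT.
    move=> t; rewrite !inE => /orP[]/eqP->.
      by rewrite (coroot_elt_diag adm) // dualN dc opprK.
    by rewrite (coroot_elt_diag adm RNd) coroot_elt_opp // cdm opprK.
  by move=> cd; case: Rcd; rewrite cd addNr eqxx.
have [_ _ simp] := Ls; have [_ [x ax x0]] := Ra.
have Ca : C a by apply: conn_refl.
have [C0|LsT] := simp (LS C) (absorbing_ideal CR CN abs).
  by have := wt_LS Ca ax; rewrite C0 => /eqP; rewrite (negPf x0).
apply: contrapT => nCb; have [b0 [y bty y0]] := Rb.
move/negP: y0; apply; apply/eqP.
apply: (LS_wt_notin (C := C) (b := b)) => //; last by rewrite LsT.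
by move=> /CR[]; rewrite eqxx.
Qed.

End RootSubalgebras.

(** * Centers of root subalgebras *)
Section Centers.
Variables (F : fieldType) (L : lieAlgType F) (H : set L).
Hypothesis char0 : [pchar F] =i pred0.
Hypothesis Llf : locally_finite_lie [set: L].
Hypothesis Lsimple : simple_lie [set: L].
Hypothesis adm : admissible [set: L] H.
Hypothesis Lfin : forall a, root_system [set: L] H a ->
      fin_dim (weight_space [set: L] H a).

Local Notation R := (root_system [set: L] H).
Local Notation wt := (weight_space [set: L] H).
Local Notation cartan := (cartan_part [set: L] H).
Local Notation LS := (root_subalgebra [set: L] H).

Implicit Types (C S : set (dual H)) (a b c d : dual H).

Lemma center_trivial (z : L) : (forall x, [lie z, x] = 0) -> z = 0.
Proof.
move=> z0; have [_ [x [y [_ _ xy]]] simp] := Lsimple.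
pose Z := [set z : L | forall x, [lie z, x] = 0].
have idl : is_ideal [set: L] Z.
  split => //.
    split=> [w|k u v u0 v0 w]; first exact: lie0l.
    by rewrite lieDl lieZl u0 v0 scaler0 addr0.
  by move=> u v _ v0 w; rewrite lie_bracketl !v0 lie0r subrr.
have [Z0|ZT] := simp Z idl; first by have : Z z := z0; rewrite Z0.
have Zx : Z x by rewrite ZT.
by have /eqP := Zx y; rewrite (negPf xy).
Qed.

Lemma root_central_eq0 (z : L) : (forall b x, R b -> wt b x -> [lie z, x] = 0) -> z = 0.
Proof.
move=> zR; apply: center_trivial => x.
have : LS R x by rewrite (LS_all_roots char0 Llf adm).
apply: (@LS_min _ _ _ R [set x | [lie z, x] = 0]).
- split; first exact: lie0r.
  by move=> k u v /= u0 v0; rewrite lieDr lieZr u0 v0 scaler0 addr0.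
- by move=> b u Rb bu; apply: zR bu.
- move=> b u v Rb bu bv /=; rewrite lie_derivation (zR b u) // (zR (- b) v) //.
    by rewrite lie0l lie0r addr0.
  exact: root_opp.
Qed.

(** Let v = [z, x] be nonzero with [z, v] = 0, and (v, h, y) an sl_2-triple. Then
    ad v kills [z, y], which has weight - b, so [z, y] = 0 by sl_2-theory and
    [z, [x, y]] = [v, y] = h. On the root space of b the operator h is the scalar
    2 and also a commutator: its trace gives a contradiction. *)
Lemma ad_nilpotent_wt0 (z : L) b n : wt 0 z -> R b ->
  (forall x, wt b x -> iter n (lie z) x = 0) -> forall x, wt b x -> [lie z, x] = 0.
Proof.
move=> z0 Rb znil.
have zwt c x : wt c x -> wt c [lie z, x].
  by move=> cx; rewrite -[c]add0r; apply: wt_bracket.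
suff key x : wt b x -> [lie z, [lie z, x]] = 0 -> [lie z, x] = 0.
  move=> x bx; have := znil x bx; elim: n x bx {znil} => [x _ /= ->|n IH x bx].
    exact: lie0r.
  by rewrite iterSr => /(IH _ (zwt _ _ bx)) /(key _ bx).
move=> bx zv0; apply: contrapT => /eqP v0; set v := [lie z, x] in zv0 v0.
have bv : wt b v by apply: zwt.
have [y t] := ex_triple adm Rb bv v0; have [_ byn Hh st] := t.
have zh : [lie z, [lie v, y]] = 0.
  by rewrite lieC (weight0_central z0 Hh) oppr0.
have zy0 : [lie z, y] = 0.
  have Nzy : wt (- b) [lie z, y] by apply: zwt.
  apply: contrapT => /eqP zy.
  have Nb0 : - b != 0 by rewrite oppr_eq0; case: Rb.
  have [m ym] := ad_root_nilpotent char0 Llf adm [lie z, y] Nb0 byn.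
  have := @sl2_lower_neq0 _ _ char0 _ _ _ (sl2_swap st) [lie z, y] 2 m zy _ ym.
  rewrite lieNl (wtE Nzy Hh) dualN (triple_ev t v0) scaleNr opprK => /(_ erefl).
  have vzy : [lie v, [lie z, y]] = 0.
    by move: zh; rewrite lie_derivation zv0 lie0l add0r.
  by rewrite /= vzy lie0r eqxx.
have zw : [lie z, [lie x, y]] = [lie v, y] by rewrite lie_derivation zy0 lie0r addr0.
have w0 : wt 0 [lie x, y] by rewrite -(subrr b); apply: wt_bracket.
have := @commutator_not_scalar _ char0 _ _ (Lfin Rb) v (lie z) (lie [lie x, y]) 2 bv v0
  (@lie_linear _ _ z) (@lie_linear _ _ _) (zwt b) _ _.
move=> h; have /eqP : (2 : F) = 0.
  apply: h => u bu; first by rewrite -[b]add0r; apply: wt_bracket.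
  rewrite -lie_bracketl zw (wtE bu Hh).
  by rewrite (triple_ev t v0).
by rewrite (natF_eq0 char0 2).
Qed.

Lemma cartan_commutators C z : (forall c, C c -> C (- c)) -> cartan C z ->
  exists k (x y : 'I_k -> L), [/\ forall i, LS C (x i), forall i, LS C (y i) &
    z = \sum_i [lie x i, y i]].
Proof.
move=> CN Cz.
suff [s [sC ->]] : exists s : seq (L * L),
    (forall p, p \in s -> LS C p.1 /\ LS C p.2) /\ z = \sum_(p <- s) [lie p.1, p.2].
  exists (size s), (fun i => (tnth (in_tuple s) i).1), (fun i => (tnth (in_tuple s) i).2).
  split; last by rewrite big_tnth.
    by move=> i; apply: (sC _ _).1; apply: mem_tnth.
  by move=> i; apply: (sC _ _).2; apply: mem_tnth.
move: z Cz; apply: (@cartan_min _ _ _ C [set z | exists s : seq (L * L),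
    (forall p, p \in s -> LS C p.1 /\ LS C p.2) /\ z = \sum_(p <- s) [lie p.1, p.2]]).
  split; first by exists [::]; rewrite big_nil.
  move=> k _ _ [s [sC ->]] [t [tC ->]].
  exists ([seq (k *: p.1, p.2) | p <- s] ++ t); split.
    move=> p; rewrite mem_cat => /orP[/mapP[q sq ->]|/tC //]; have [? ?] := sC q sq.
    by split => //=; apply: (subspaceZ _ (LS_subspace _)).
  rewrite big_cat big_map scaler_sumr /=; congr (_ + _).
  by apply: eq_bigr => p _; rewrite lieZl.
move=> a x y Ca ax ay; exists [:: (x, y)]; split; last by rewrite big_seq1.
move=> p; rewrite inE => /eqP->; split; first exact: wt_LS ax.
exact: wt_LS (CN a Ca) ay.
Qed.

Lemma LS_fin_dim S : finite_set S -> S `<=` R -> (forall c, S c -> S (- c)) -> fin_dim (LS S).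
Proof.
move=> fS SR SN; apply: fin_dimU; last by apply: fin_dim_sum => // a /SR; apply: Lfin.
apply: fin_dim_sum => // a Sa.
have [X fX XE] := Lfin (SR a Sa); have [Y fY YE] := Lfin (SR _ (SN a Sa)).
exists [set [lie x, y] | x in X & y in Y]; first exact: finite_image2.
apply/seteqP; split; apply: span_min; try exact: span_subspace; last first.
  move=> _ [x Xx [y Yy <-]]; apply: span_incl; exists x; first by rewrite XE; apply: span_incl.
  by exists y => //; rewrite YE; apply: span_incl.
move=> _ [x ax [y ay <-]]; rewrite XE in ax; rewrite YE in ay.
move: x ax; apply: (@span_min _ _ X [set x | lin_span _ [lie x, y]]).
  split; first by rewrite /= lie0l; apply: (subspace0 (span_subspace _)).
  by move=> k u v /= hu hv; rewrite lieDl lieZl; exact: ((span_subspace _).2 _ _ _ hu hv).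
move=> x Xx /=; move: y ay; apply: (@span_min _ _ Y [set y | lin_span _ [lie x, y]]).
  split; first by rewrite /= lie0r; apply: (subspace0 (span_subspace _)).
  by move=> k u v /= hu hv; rewrite lieDr lieZr; exact: ((span_subspace _).2 _ _ _ hu hv).
by move=> y Yy; apply: span_incl; exists x => //; exists y.
Qed.

(** A central z is a sum of commutators commuting with all of them, so ad z is
    nilpotent on any finite dimensional subalgebra containing L_S. Taking
    subalgebras that contain a given root space of L, z centralizes L. *)
Lemma LS_cartan_center S z : finite_set S -> S `<=` R -> (forall c, S c -> S (- c)) ->
  cartan S z -> (forall x, LS S x -> [lie z, x] = 0) -> z = 0.
Proof.
move=> fS SR SN Sz zS; apply: root_central_eq0 => b x Rb; move: x.
have [X /finite_seqP[s ->] XE] := LS_fin_dim fS SR SN.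
have [Y /finite_seqP[t ->] YE] := Lfin Rb.
have fG := generated_fin_dim Llf (s ++ t); set G := smallest _ _ in fG.
have [sG lG] : is_subalgebra G by apply: generated_subalgebra.
have SG : LS S `<=` G.
  rewrite XE; apply: span_min => // u su; apply: generated_incl.
  by rewrite /= mem_cat su.
have bG : wt b `<=` G.
  rewrite YE; apply: span_min => // u tu; apply: generated_incl.
  by rewrite /= mem_cat tu orbT.
have [k [x [y [xS yS zE]]]] := cartan_commutators SN Sz.
have Gz : G z by apply: SG; apply: (cartan_LS Sz).
have [] := @commuting_commutator_sum_nilpotent _ char0 _ G fG k (lie z)
  (fun i => lie (x i)) (fun i => lie (y i)).
- exact: lie_linear.
- by move=> i; apply: lie_linear.
- by move=> i; apply: lie_linear.
- by move=> v; apply: lG.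
- by move=> i v; apply: lG; apply: SG.
- by move=> i v; apply: lG; apply: SG.
- move=> v _; rewrite zE lie_suml; apply: eq_bigr => i _.
  by rewrite lie_bracketl.
- by move=> i v _; rewrite lie_derivation zS // lie0l add0r.
move=> n nil; apply: (ad_nilpotent_wt0 (n := n) (cartan_wt0 Sz) Rb) => u bu.
by apply: nil; apply: bG.
Qed.

End Centers.

(** * The subalgebra of a finite irreducible closed subsystem *)
Section Subsystems.
Variables (F : fieldType) (L : lieAlgType F) (H : set L).
Hypothesis char0 : [pchar F] =i pred0.
Hypothesis Llf : locally_finite_lie [set: L].
Hypothesis Lsimple : simple_lie [set: L].
Hypothesis adm : admissible [set: L] H.
Hypothesis Lfin : forall a, root_system [set: L] H a ->
      fin_dim (weight_space [set: L] H a).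

Local Notation R := (root_system [set: L] H).
Local Notation wt := (weight_space [set: L] H).
Local Notation W := (lin_span R).
Local Notation cartan := (cartan_part [set: L] H).
Local Notation LS := (root_subalgebra [set: L] H).

Variable S : set (dual H).
Hypothesis IS : fin_irr_closed_subsystem W R S.

Implicit Types (a b c d : dual H).

Lemma S_nonempty : S !=set0. Proof. by case: IS => -[]. Qed.
Lemma S_roots : S `<=` R. Proof. by case: IS => -[]. Qed.
Lemma S_finite : finite_set S. Proof. by case: IS. Qed.
Lemma S_irreducible : irreducible_in W R S. Proof. by case: IS. Qed.
Lemma S_closed : closed_in R S. Proof. by case: IS. Qed.

Lemma S_reflection a b : S a -> S b -> S (b - (b (coroot_elt a) : F) *: a).
Proof.
move=> Sa Sb; have [[_ _ refl] _ _ _] := IS; have := refl a b Sa Sb.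
by rewrite /reflection (corootE char0 Llf adm) //; apply: S_roots.
Qed.

Lemma S_opp a : S a -> S (- a).
Proof.
move=> Sa; have := S_reflection Sa Sa; rewrite (coroot_elt_diag adm (S_roots Sa)).
by rewrite scaler_nat mulr2n opprD addrA subrr add0r.
Qed.

Lemma S_not0 : ~ S 0.
Proof. by move=> /S_roots[]; rewrite eqxx. Qed.

Lemma coroot_elt_cartan a : S a -> cartan S (coroot_elt a).
Proof.
move=> Sa; have [[ax ay _ _] _] := root_vectorsP adm (S_roots Sa).
exact: cartan_bracket ax ay.
Qed.

Lemma coroot_elt_neq0 a : R a -> coroot_elt a != 0.
Proof.
move=> Ra; apply/eqP => h0; have [[_ _ _ [hx _ _]] x0] := root_vectorsP adm Ra.
move: hx; rewrite -/(coroot_elt a) h0 lie0l => /esym/eqP.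
by rewrite scaler_eq0 (negPf x0) (natF_eq0 char0 2).
Qed.

Local Notation HS := (H `&` LS S).

Lemma coroot_elt_HS a : S a -> HS (coroot_elt a).
Proof.
move=> Sa; split; first exact: (coroot_elt_H adm (S_roots Sa)).
exact: cartan_LS (coroot_elt_cartan Sa).
Qed.

(** Two roots that agree on the coroots of both are equal, so the coroots of S
    suffice to distinguish its elements. *)
Lemma HS_separates a b : S a \/ a = 0 -> S b \/ b = 0 -> a != b ->
  exists2 h, HS h & a h != b h.
Proof.
have two0 : (2 : F) != 0 by rewrite (natF_eq0 char0 2).
have sep0 c : S c -> exists2 h, HS h & c h != 0.
  by move=> Sc; exists (coroot_elt c); [apply: coroot_elt_HS|rewrite (coroot_elt_diag adm) //; apply: S_roots].
move=> [Sa|->] [Sb|->] ab; rewrite ?eqxx // in ab *.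
- apply: contrapT => nsep; move/negP: ab; apply; apply/eqP.
  have tS t : t \in [:: a; b] -> S t by rewrite !inE => /orP[]/eqP->.
  apply: (root_determined char0 Llf adm (T := [:: a; b])).
  + by move=> t /tS /S_roots.
  + exact: S_roots.
  + exact: S_roots.
  + by apply: span_incl; rewrite /= inE eqxx.
  + by apply: span_incl; rewrite /= !inE eqxx orbT.
  move=> t /tS St; apply/eqP; apply: contrapT => /negP neq.
  by apply: nsep; exists (coroot_elt t) => //; apply: coroot_elt_HS.
- exact: sep0.
by have [h Hh bh] := sep0 b Sb; exists h => //; rewrite dual0 eq_sym.
Qed.

Lemma LS_weight_restrict b x : S b \/ b = 0 -> LS S x ->
  (forall h, HS h -> [lie h, x] = (b h : F) *: x) -> wt b x.
Proof.
move=> Sb Sx bx; pose X := [set v : L | forall h, HS h -> [lie h, v] = (b h : F) *: v].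
have sX : is_subspace X.
  split=> [h _|k u v Xu Xv h Hh]; first by rewrite lie0r scaler0.
  by rewrite lieDr lieZr Xu // Xv // scalerDr !scalerA mulrC.
have HX h v : HS h -> X v -> X [lie h, v].
  by move=> Hh Xv g Hg; rewrite (Xv h Hh) lieZr (Xv g Hg) !scalerA mulrC.
have [z [s [u [[Cz sS uw xE] [Xz Xu]]]]] :=
  LS_components sX (@subIsetl _ _ _) HX HS_separates S_not0 Sx bx.
have Xwt c v : S c \/ c = 0 -> wt c v -> X v -> wt b v.
  move=> Sc cv Xv; have [<-//|cb] := eqVneq c b.
  have [h Hh ch] := HS_separates Sc Sb cb.
  have := Xv h Hh; rewrite (wtE cv Hh.1) => /eqP.
  rewrite -subr_eq0 -scalerBl scaler_eq0 subr_eq0 (negPf ch) => /eqP ->.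
  exact: subspace0 (wt_subspace b).
rewrite xE; apply: (subspaceD (wt_subspace b)).
  by apply: (Xwt 0 z) => //; [right|apply: cartan_wt0 Cz].
apply: (subspace_big (wt_subspace b)) => a sa _.
by apply: (Xwt a) => //; [left; apply: sS|apply: Xu].
Qed.

Lemma LS_subalgebra : is_subalgebra (LS S).
Proof.
split=> [|x y]; first exact: LS_subspace.
move=> Sx Sy; move: x Sx; apply: (@LS_min _ _ _ S [set x | LS S [lie x, y]]).
- split; first by rewrite /= lie0l; apply: (subspace0 (LS_subspace S)).
  by move=> k u v /= hu hv; rewrite lieDl lieZl; exact: ((LS_subspace S).2 _ _ _ hu hv).
- move=> a x Sa ax; apply: (LS_bracket_root S_roots S_opp _ _ ax Sy); last by left.
  by move=> c Sc Rac; apply: S_closed.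
- move=> a x z Sa ax az; apply: LS_bracket_wt0 Sy.
  by rewrite -(subrr a); apply: wt_bracket.
Qed.

Lemma LS_centralizer (z : L) : (forall a x, S a -> wt a x -> [lie z, x] = 0) ->
  forall x, LS S x -> [lie z, x] = 0.
Proof.
move=> zS; apply: (@LS_min _ _ _ S [set x | [lie z, x] = 0]).
- split; first exact: lie0r.
  by move=> k u v /= u0 v0; rewrite lieDr lieZr u0 v0 scaler0 addr0.
- by move=> a x Sa; apply: zS.
- move=> a x y Sa ax ay /=; rewrite lie_derivation (zS a x) // (zS (- a) y) //.
    by rewrite lie0l lie0r addr0.
  exact: S_opp.
Qed.

(** An ideal X that contains a nonzero root vector contains its coroot, hence all
    root spaces on which this coroot is not zero, and by connectedness all root
    spaces of S. An ideal without root vectors lies in the Cartan part, commutes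
    with the root spaces, and is central. *)
Lemma LS_simple : simple_lie (LS S).
Proof.
have [a0 Sa0] := S_nonempty; split; first exact: LS_subalgebra.
  have [[ax _ Hh [hx _ _]] x0] := root_vectorsP adm (S_roots Sa0).
  exists (coroot_elt a0), (root_vectors a0).1; split.
  - exact: (coroot_elt_HS Sa0).2.
  - exact: wt_LS Sa0 ax.
  - by rewrite /coroot_elt hx scaler_eq0 (negPf x0) (natF_eq0 char0 2).
move=> X [sX XS idl].
have idr x y : LS S y -> X x -> X [lie x, y].
  by move=> Sy Xx; rewrite lieC; apply: subspaceN => //; apply: idl.
have [[a [x [Sa ax Xx x0]]]|noroot] :=
    pselect (exists a x, [/\ S a, wt a x, X x & x != 0]).
  right; apply/seteqP; split => //.
  have grow c b v : S c -> S b -> b (coroot_elt c) != 0 -> wt c v -> X v -> v != 0 -> wt b `<=` X.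
    move=> Sc Sb bc cv Xv v0 u bu.
    have [y t] := ex_triple adm (S_roots Sc) cv v0; have [_ cy Hh _] := t.
    have Sy : LS S y := wt_LS (S_opp Sc) cy.
    have Xh : X [lie v, y] by apply: idr.
    have := idr _ u (wt_LS Sb bu) Xh; rewrite (wtE bu Hh).
    rewrite (triple_corootE char0 Llf adm (S_roots Sc) (S_roots Sb) t v0) => Xu.
    have := subspaceZ (b (coroot_elt c) : F)^-1 sX Xu; by rewrite scalerA mulVf // scale1r.
  have Xa : wt a `<=` X.
    apply: (grow a a x) => //; rewrite (coroot_elt_diag adm (S_roots Sa)).
    by rewrite (natF_eq0 char0 2).
  have all_roots b : S b -> wt b `<=` X.
    move=> Sb; have [s [sS ps <-]] := S_irreducible Sa Sb.
    elim: s a {Sa ax x0 Sb} Xa sS ps => //= c s IH a Xa sS /andP[ac ps].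
    have Sa : S a by apply: sS; apply: mem_head.
    have Sc : S c by apply: sS; rewrite !inE eqxx orbT.
    apply: IH ps => [|d ds]; last by apply: sS; rewrite inE ds orbT.
    have [_ [v av v0]] := S_roots Sa.
    apply: (grow a c v) => //; last exact: Xa.
    apply: (coroot_neq0_sym char0 Llf adm); try exact: S_roots.
    by move: ac; rewrite (corootE char0 Llf adm) //; apply: S_roots.
  apply: LS_min => // [b u Sb|b u v Sb bu bv]; first exact: all_roots.
  by apply: idl; [apply: wt_LS bu|apply: (all_roots (- b)) => //; apply: S_opp].
left; apply/seteqP; split=> [z Xz|_ ->]; last exact: subspace0.
have noX a x : S a -> wt a x -> X x -> x = 0.
  move=> Sa ax Xx; apply: contrapT => /eqP x0; apply: noroot.
  by exists a, x.
have Cz : cartan S z.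
  have HX h v : HS h -> X v -> X [lie h, v] by move=> [_ Sh]; apply: idl.
  have [y [s [u [[Cy sS uw zE] [Xy Xu]]]]] :=
    LS_components sX (@subIsetl _ _ _) HX HS_separates S_not0 (XS z Xz) Xz.
  rewrite zE big_seq big1 ?addr0 // => a sa.
  by apply: (noX a) => //; [apply: sS|apply: Xu].
apply: (LS_cartan_center char0 Llf Lsimple adm Lfin S_finite S_roots S_opp Cz).
apply: LS_centralizer => a x Sa ax; apply: (noX a) => //.
  by rewrite -[a]add0r; apply: wt_bracket ax; apply: cartan_wt0 Cz.
by apply: idr => //; apply: wt_LS ax.
Qed.

Local Notation ws := (weight_space (LS S) HS).
Local Notation restr := (restrict_dual (LS S)).

Lemma restrE a h : HS h -> restr a h = a h.
Proof. by move=> [_ Sh]; apply: restrict_dualE. Qed.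

Lemma restr_opp a : restr (- a) = - restr a.
Proof. by apply: dual_eq => h Hh; rewrite dualN !restrE. Qed.

Lemma restr0 : restr (0 : dual H) = 0.
Proof. by apply: dual_eq => h Hh; rewrite restrE. Qed.

Lemma restr_inj a b : S a \/ a = 0 -> S b \/ b = 0 -> restr a = restr b -> a = b.
Proof.
move=> Sa Sb rab; apply/eqP; apply: contrapT => /negP ab.
have [h Hh] := HS_separates Sa Sb ab.
by rewrite -restrE // rab restrE // eqxx.
Qed.

Lemma wt_restr a x : LS S x -> wt a x -> ws (restr a) x.
Proof. by move=> Sx ax; split => // h Hh; rewrite (wtE ax Hh.1) restrE. Qed.

Lemma restr_wt a x : S a \/ a = 0 -> ws (restr a) x -> wt a x.
Proof.
move=> Sa [Sx ax]; apply: LS_weight_restrict => // h Hh.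
by rewrite ax // restrE.
Qed.

Lemma HS_toral : toral (LS S) HS.
Proof.
split.
- split=> [|x y [Hx Sx] [Hy Sy]].
    by apply: subspaceI; [apply: H_subspace|apply: LS_subspace].
  rewrite (H_abelian adm Hx Hy).
  by split; [apply: (subspace0 (H_subspace adm))|apply: (subspace0 (LS_subspace S))].
- exact: subIsetr.
- have [a Sa] := S_nonempty; exists (coroot_elt a); first exact: coroot_elt_HS.
  exact: (coroot_elt_neq0 (S_roots Sa)).
- apply/seteqP; split.
    apply: span_min; first exact: LS_subspace.
    by move=> x [a _ []].
  move=> x /LS_dec[z [s [u [Cz _ sS uw ->]]]].
  have sub : is_subspace (subspace_sum setT ws) by apply: span_subspace.
  apply: (subspaceD sub).
    apply: span_incl; exists (restr 0) => //.
    by apply: wt_restr; [apply: cartan_LS Cz|apply: cartan_wt0 Cz].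
  apply: (subspace_big sub) => a sa _; apply: span_incl; exists (restr a) => //.
  by apply: wt_restr => //; apply: wt_LS (uw a); apply: sS.
- exact: weight_independent.
Qed.

Lemma LS_root_system : root_system (LS S) HS = restr @` S.
Proof.
apply/seteqP; split=> [al [al0 [x [Sx alx] x0]]|_ [a Sa <-]]; last first.
  have [_ [x ax x0]] := S_roots Sa; split.
    apply: contra_notN S_not0 => /eqP; rewrite -restr0 => /restr_inj <- //.
      by left.
    by right.
  by exists x => //; apply: wt_restr => //; apply: wt_LS ax.
pose X := ws al.
have sX : is_subspace X by apply: weight_subspace; apply: LS_subspace.
have HX h v : HS h -> X v -> X [lie h, v].
  by move=> Hh alv; have [_ ->] := alv; last by []; apply: subspaceZ.
have [z [s [u [[Cz sS uw xE] [Xz Xu]]]]] :=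
  LS_components sX (@subIsetl _ _ _) HX HS_separates S_not0 Sx (conj Sx alx).
have z0 : z = 0.
  apply: (weight_eq0 al0 Xz); rewrite -restr0; apply: wt_restr.
    exact: cartan_LS Cz.
  exact: cartan_wt0 Cz.
apply: contrapT => nal; move/negP: x0; apply; apply/eqP.
rewrite xE z0 add0r big_seq big1 // => a sa.
apply: (weight_eq0 (a := al) (b := restr a)) (Xu a sa) _.
  by apply: contra_notN nal => /eqP->; exists a => //; apply: sS.
by apply: wt_restr => //; apply: wt_LS (uw a); apply: sS.
Qed.

Lemma LS_admissible : admissible (LS S) HS.
Proof.
have wsopp a x : S a -> wt (- a) x -> ws (- restr a) x.
  move=> Sa ax; rewrite -restr_opp; apply: wt_restr => //.
  by apply: wt_LS ax; apply: S_opp.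
split; first exact: HS_toral.
  move=> h [Hh Sh]; have := LS_wt0 S_not0 Sh (H_wt0 adm Hh).
  apply: cartan_min; first exact: span_subspace.
  move=> a x y Sa ax ay; apply: span_incl; exists (restr a).
    by rewrite LS_root_system; exists a.
  apply: span_incl; exists x; first by apply: wt_restr => //; apply: wt_LS ax.
  by exists y => //; apply: wsopp.
move=> al x; rewrite LS_root_system => -[a Sa <-] ax x0.
have {}ax : wt a x by apply: restr_wt ax; left.
have [y [_ ay Hh [hx hy _]]] := ex_triple adm (S_roots Sa) ax x0.
exists y; split => //; first exact: wsopp.
split => //; apply: cartan_LS; exact: cartan_bracket ax ay.
Qed.

Lemma cartan_root_disjoint : cartan S `&` root_part [set: L] H S = [set 0].
Proof.
apply/seteqP; split=> [x [Cx rx]|_ ->]; last first.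
  by split; apply: (subspace0 (span_subspace _)).
have x0 := cartan_wt0 Cx.
move: rx => /(subspace_sum_comb (@wt_subspace _ _ H))[s [u [us sS uw xE]]].
have comp a : a \in s -> wt 0 (u a).
  apply: (@weight_components _ _ H (wt 0) _ (fun a : dual H => a : L -> F)) => //.
  - exact: wt_subspace.
  - by move=> h v; apply: H_wt_stable.
  - by move=> b c _ _; apply: dual_neq.
  - by move=> b h _ Hh; apply: wtE.
  - by rewrite -xE.
rewrite xE big_seq big1 // => a sa; apply: (weight_eq0 _ (comp a sa) (uw a)).
by apply: contra_notN S_not0 => /eqP->; apply: sS.
Qed.

End Subsystems.

(** * Maximality of the toral subalgebra of a subsystem *)
Section Maximality.
Variables (F : fieldType) (L : lieAlgType F) (H : set L).
Hypothesis char0 : [pchar F] =i pred0.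
Hypothesis Llf : locally_finite_lie [set: L].
Hypothesis Lsimple : simple_lie [set: L].
Hypothesis adm : admissible [set: L] H.
Hypothesis Lfin : forall a, root_system [set: L] H a ->
      fin_dim (weight_space [set: L] H a).

Local Notation R := (root_system [set: L] H).
Local Notation wt := (weight_space [set: L] H).
Local Notation W := (lin_span R).
Local Notation cartan := (cartan_part [set: L] H).
Local Notation LS := (root_subalgebra [set: L] H).

Variable S : set (dual H).
Hypothesis IS : fin_irr_closed_subsystem W R S.

Local Notation HS := (H `&` LS S).

Implicit Types (a b c : dual H).

(** Let t act on the root space of a by the scalar u(a). Then u is additive along
    root strings, hence is reflected like a functional, and the invariant form of
    the finite root system S attaches to u an element h of H with a(h) = u(a). So
    t - h is central in L_S. *)
Lemma scalar_action_in_H (t : L) : cartan S t ->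
  (forall a, S a -> exists k : F, forall x, wt a x -> [lie t, x] = k *: x) -> HS t.
Proof.
move=> Ct tS; have t0 := cartan_wt0 Ct; have SR := S_roots IS; have Sopp := S_opp char0 Llf adm IS.
have /choice[u uP] a : exists k : F, S a -> forall x, wt a x -> [lie t, x] = k *: x.
  by have [/tS[k]|nSa] := pselect (S a); [exists k|exists 0].
have uopp b : S b -> u (- b) = - u b.
  move=> Sb; have [[bx bny Hh _] _] := root_vectorsP adm (SR b Sb).
  have : [lie t, coroot_elt b] = 0 by rewrite lieC (weight0_central t0 Hh) oppr0.
  rewrite /coroot_elt lie_derivation (uP b) // (uP (- b)) // ?lieZl ?lieZr; last exact: Sopp.
  rewrite -scalerDl => /eqP; rewrite scaler_eq0 (negPf (coroot_elt_neq0 char0 adm (SR b Sb))) orbF.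
  by rewrite addrC addr_eq0 => /eqP.
have urefl a b : S a -> S b -> u (a - (a (coroot_elt b) : F) *: b) = u a - (a (coroot_elt b) : F) * u b.
  move=> Sa Sb; have [_ [v av v0]] := SR a Sa.
  have [tri x0] := root_vectorsP adm (SR b Sb); have [bx bny _ _] := tri.
  have [w [sw w0 Gw]] := weight_reflection char0 Llf adm tri x0 av v0.
  (* G follows the eigenvalue of t along the root string of a in direction b. *)
  pose G := [set v : L | exists n : int, wt (a + n%:~R *: b) v /\
    [lie t, v] = (u a + n%:~R * u b) *: v].
  have [|||n [nw tw]] := Gw G.
  - by exists 0; rewrite scale0r addr0 mul0r addr0; split => //; apply: uP.
  - move=> z [n [nz tz]]; exists (n + 1); split.
      by rewrite rmorphD scalerDl scale1r addrA addrC; apply: wt_bracket.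
    rewrite lie_derivation (uP b) // tz lieZl lieZr -scalerDl rmorphD; congr (_ *: _).
    by ring.
  - move=> z [n [nz tz]]; exists (n - 1); split.
      by rewrite rmorphB scalerBl scale1r addrA addrC; apply: wt_bracket.
    rewrite lie_derivation (uP (- b)) //; last exact: Sopp.
    rewrite tz lieZl lieZr -scalerDl uopp // rmorphB; congr (_ *: _).
    by ring.
  have Ssab := S_reflection char0 Llf adm IS Sb Sa.
  have kn : (n%:~R : F) = - (a (coroot_elt b) : F).
    have [/addrI /eqP|ne] := eqVneq (a + n%:~R *: b) (a - (a (coroot_elt b) : F) *: b).
      rewrite -subr_eq0 -scaleNr -scalerBl scaler_eq0 (negPf (root_neq0 (SR b Sb))) orbF.
      by rewrite subr_eq0 => /eqP.
    by move/negP: w0; case; apply/eqP; apply: weight_eq0 ne nw sw.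
  have := uP _ Ssab w sw; rewrite tw kn => /eqP.
  rewrite -subr_eq0 -scalerBl scaler_eq0 (negPf w0) orbF subr_eq0 mulNr.
  by move=> /eqP <-.
have /finite_seqP[s0 sE] := S_finite IS; pose s := undup s0.
have us : uniq s by apply: undup_uniq.
have sS a : a \in s -> S a by rewrite mem_undup sE.
have Ss a : S a -> a \in s by rewrite mem_undup sE.
have sR a : a \in s -> R a by move=> /sS /SR.
have refl_s a b : a \in s -> b \in s -> b - (b (coroot_elt a) : F) *: a \in s.
  by move=> /sS Sa /sS Sb; apply: Ss; apply: (S_reflection char0 Llf adm IS).
pose N a := \sum_(b <- s) (b (coroot_elt a) : F) ^+ 2.
have N0 a : a \in s -> N a != 0.
  move=> sa; apply: (sum_squares_neq0 char0 sa); first exact: (coroot_elt_diag adm (sR a sa)).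
  by move=> b sb; apply: (root_coroot_int char0 Llf adm); apply: sR.
have hsH : is_subspace HS by apply: subspaceI; [apply: H_subspace adm|apply: LS_subspace].
(* In the form of S, a(h_b) N_a = 2 (h_a, h_b) is symmetric in a and b, which
   moves b in b(h) to the place where u is summed against it. *)
pose h := \sum_(a <- s) (2 * u a / N a) *: coroot_elt a.
have Hh : HS h.
  apply: (subspace_big hsH) => a sa _; apply: (subspaceZ _ hsH).
  exact: (coroot_elt_HS adm IS (sS a sa)).
have hE b : S b -> b h = u b.
  move=> Sb; have sb := Ss b Sb; rewrite (dual_comb b _ (H_subspace adm)); last first.
    by move=> a /sR /(coroot_elt_H adm).
  have ev a : a \in s -> 2 * u a / N a * b (coroot_elt a) =
      (N b)^-1 * (2 * ((a (coroot_elt b) : F) * u a)).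
    move=> sa; have E1 := form_coroot adm (coroot_elt b) sR us refl_s sa.
    have E2 := form_coroot adm (coroot_elt a) sR us refl_s sb.
    have E : (b (coroot_elt a) : F) = (a (coroot_elt b) : F) * N a / N b.
      apply: (mulIf (N0 b sb)); rewrite divfK ?N0 // -E1 -E2; congr (2 * _).
      by apply: eq_bigr => c _; rewrite mulrC.
    by rewrite E; field; rewrite !N0.
  rewrite big_seq (eq_bigr _ ev) -big_seq -!mulr_sumr.
  rewrite (reflection_sum (u := u) us (coroot_elt_diag adm (sR b sb))) => [|c sc|c sc].
  - by rewrite mulrC -mulrA mulfV ?mulr1 // N0.
  - exact: refl_s.
  - by apply: urefl => //; apply: sS.
have th0 : t - h = 0.
  have SH := LS_wt0 (S_not0 IS) Hh.2 (H_wt0 adm Hh.1).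
  apply: (LS_cartan_center char0 Llf Lsimple adm Lfin (S_finite IS) SR Sopp).
    exact: subspaceB (cartan_subspace S) Ct SH.
  apply: (LS_centralizer char0 Llf adm IS) => a x Sa ax.
  by rewrite lieBl (uP a) // (wtE ax Hh.1) hE // subrr.
by have -> : t = h by apply/eqP; rewrite -subr_eq0 th0.
Qed.

(** Suppose that H' contains H_S and is toral in L_S. If two H'-weights d1 and d2
    occurred in the root space of a, then sl_2-theory, for a triple starting from
    a vector of weight d1, would carry a vector of weight - d2 to one of weight
    2 d1 - d2, and so on along an infinite progression of weights of that finite
    dimensional space. So H' acts on each root space by scalars. *)
Lemma HS_maximal_toral : maximal_toral (LS S) HS.
Proof.
split; first exact: (HS_toral char0 adm IS).
move=> H' torH' HH'; apply/seteqP; split => //.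
have SR := S_roots IS; have Sopp := S_opp char0 Llf adm IS.
have subS := LS_subalgebra char0 Llf adm IS.
have [aH' H'S _ gen' _] := torH'.
have ab' t t' : H' t -> H' t' -> [lie t, t'] = 0 by apply: (toral_abelian subS torH').
have C' t : H' t -> cartan S t.
  move=> H't; have St := H'S t H't; apply: (LS_wt0 (S_not0 IS)) => //.
  apply: (LS_weight_restrict char0 Llf adm IS) => //; first by right.
  by move=> h /HH' H'h; rewrite ab' // dual0 scale0r.
have wt' a x t : H' t -> wt a x -> wt a [lie t, x].
  by move=> /C' /cartan_wt0 t0 ax; rewrite -[a]add0r; apply: wt_bracket.
pose w' := weight_space (LS S) H'.
have sw' (d : dual H') : is_subspace (w' d) by apply: weight_subspace; apply: LS_subspace.
have dec a x : S a -> wt a x -> exists (r : seq (dual H')) (v : dual H' -> L),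
    [/\ uniq r, (forall d, w' d (v d)), (forall d, d \in r -> wt a (v d)) &
      x = \sum_(d <- r) v d].
  move=> Sa ax; have : subspace_sum setT w' x by rewrite /w' gen'; apply: wt_LS ax.
  move=> /(subspace_sum_comb sw')[r [v [ur _ vw xE]]]; exists r, v; split => //.
  apply: (@weight_components _ _ H' (wt a) _ (fun d : dual H' => d : L -> F)) => //.
  - exact: wt_subspace.
  - by move=> t y; apply: wt'.
  - by move=> d e _ _; apply: dual_neq.
  - by move=> d t _ H't; have [_ ->] := vw d.
  - by rewrite -xE.
pose D a (d : dual H') := exists x, [/\ w' d x, wt a x & x != 0].
have Dopp a d : S a -> D a d -> D (- a) (- d).
  move=> Sa [x [dx ax x0]]; have [y t] := ex_triple adm (SR a Sa) ax x0.
  have [_ ay Hh _] := t.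
  have [r [v [ur vw va yE]]] := dec (- a) y (Sopp a Sa) ay.
  have H'h : H' [lie x, y].
    by apply: HH'; split => //; apply: subS.2; [apply: wt_LS ax|apply: wt_LS (Sopp a Sa) ay].
  have h0 : w' 0 [lie x, y].
    apply: centralizer_weight0; first exact: H'S.
    by move=> t' H't'; apply: ab'.
  have comp e : e \in r -> w' 0 [lie x, v e].
    apply: (@weight_components _ _ H' (w' 0) _ (fun e : dual H' => (d + e : dual H') : L -> F) r
      (fun e => [lie x, v e])) => //.
    - by move=> t' z H't' z0; rewrite (weight0_central z0 H't'); apply: subspace0.
    - by move=> f g _ _ fg; apply: dual_neq; rewrite (inj_eq (addrI d)).
    - move=> f t' _ H't'; have [_ E] := weight_bracket subS dx (vw f); exact: E.
    - by rewrite -lie_sumr -yE.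
  have [e [re xe]] : exists e, e \in r /\ [lie x, v e] != 0.
    apply: contrapT => nex; have h00 : [lie x, y] = 0.
      rewrite yE lie_sumr big_seq big1 // => e re; apply: contrapT => /eqP xe.
      by apply: nex; exists e.
    have [_ _ _ [hx _ _]] := t.
    move: hx; rewrite h00 lie0l => /esym/eqP.
    by rewrite scaler_eq0 (negPf x0) (natF_eq0 char0 2).
  have de : e = - d.
    have [/eqP|de] := eqVneq (d + e) 0; first by rewrite addrC addr_eq0 => /eqP.
    have := weight_eq0 de (weight_bracket subS dx (vw e)) (comp e re) => /eqP.
    by rewrite (negPf xe).
  exists (v e); rewrite -de; split => //; first exact: va.
  by apply: contraNneq xe => ->; rewrite lie0r.
have Drefl a d e : S a -> D a d -> D a e -> D a (2 *: d - e).
  move=> Sa [x [dx ax x0]] /(Dopp a e Sa)[y [ey ay y0]].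
  have [z t] := ex_triple adm (SR a Sa) ax x0; have [_ az Hh st] := t.
  exists [lie x, [lie x, y]]; split.
  - have -> : 2 *: d - e = d + (d - e) by rewrite scaler_nat mulr2n addrA.
    by do 2 apply: weight_bracket => //.
  - by rewrite -[a](addrK a) -addrA; do 2 apply: wt_bracket => //.
  have Na0 : - a != 0 by rewrite oppr_eq0; apply: root_neq0 (SR a Sa).
  have [m zm] := ad_root_nilpotent char0 Llf adm y Na0 az.
  apply: (@sl2_lower_neq0 _ _ char0 _ _ _ (sl2_swap st) y 2 m y0 _ zm).
  by rewrite lieNl (wtE ay Hh) dualN (triple_ev t x0) scaleNr opprK.
have Duniq a d e : S a -> D a d -> D a e -> d = e.
  move=> Sa ad ae; apply/eqP; rewrite -subr_eq0; apply/eqP.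
  apply: (finite_no_progression char0 (b := e) (finite_weights (LS S) H' (Lfin (SR a Sa)))).
  move=> n; suff [] : D a (e + n%:R *: (d - e)) /\ D a (e + n.+1%:R *: (d - e)) by [].
  elim: n => [|n [IH1 IH2]]; first by rewrite scale0r scale1r addr0 addrC subrK.
  split=> //; have := Drefl a _ _ Sa IH2 IH1; congr (D a _).
  rewrite scalerDr opprD addrACA scaler_nat mulr2n addrK scalerA -scalerBl; congr (_ + _ *: _).
  by rewrite -[n.+2%:R]natr1 -[n.+1%:R]natr1; ring.
move=> t H't; apply: scalar_action_in_H; first exact: C'.
move=> a Sa; have [_ [x0 ax0 x00]] := SR a Sa.
have [r [v [ur vw va xE]]] := dec a x0 Sa ax0.
have [d0 ad0] : exists d, D a d.
  apply: contrapT => nD; move/negP: x00; apply; apply/eqP; rewrite xE big_seq big1 // => d rd.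
  apply: contrapT => /eqP vd; apply: nD; exists d, (v d); split => //; exact: va.
exists (d0 t) => x ax; have [r' [v' [ur' vw' va' ->]]] := dec a x Sa ax.
rewrite lie_sumr scaler_sumr big_seq [RHS]big_seq; apply: eq_bigr => d rd.
have [->|vd] := eqVneq (v' d) 0; first by rewrite lie0r scaler0.
have -> : d0 = d by apply: (Duniq a) => //; exists (v' d); split => //; apply: va'.
by have [_ ->] := vw' d.
Qed.

End Maximality.

(** * Directed systems and direct limits *)
Lemma directed_glue (I T U : Type) (u0 : U) (P : set I) (B : I -> set T) (f : I -> T -> U) :
    (forall i j, P i -> P j -> exists k, [/\ P k, {in B i, f k =1 f i} & {in B j, f k =1 f j}]) ->
  exists g : T -> U, forall i, P i -> {in B i, g =1 f i}.
Proof.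
move=> dir; have /choice[g gP] x : exists u, forall i, P i -> B i x -> u = f i x.
  have [[i [Pi Bix]]|nB] := pselect (exists i, P i /\ B i x); last first.
    by exists u0 => i Pi Bix; case: nB; exists i.
  exists (f i x) => j Pj Bjx; have [k [Pk fi fj]] := dir i j Pi Pj.
  by rewrite -fi ?fj // mem_set.
by exists g => i Pi x; rewrite inE => Bix; apply: gP.
Qed.

Section DirectLimits.
Variables (F : fieldType) (I : Type) (P : set I).

Lemma rs_direct_limit_union (V : lmodType F) (A : I -> set V) (R : set V) :
  directed_family P A -> R = \bigcup_(i in P) A i -> rs_direct_limit P A R.
Proof.
move=> dirA RE; split => // V' R' f _ fm fc; have [_ dir] := dirA.
have [|g gE] := @directed_glue _ _ _ (0 : V') P (fun i => lin_span (A i)) f.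
  move=> i j Pi Pj; have [k [Pk ik jk]] := dir i j Pi Pj.
  by exists k; split => //; apply: fc.
have spanR x : lin_span R x -> exists2 i, P i & lin_span (A i) x.
  by rewrite RE; apply: span_bigcup_directed.
have gfE i x : P i -> lin_span (A i) x -> g x = f i x.
  by move=> Pi Aix; apply: gE => //; rewrite inE.
exists g; split => //.
- split=> [c x y Rx Ry _|a].
    have [[i Pi Aix] [j Pj Ajy]] := (spanR x Rx, spanR y Ry).
    have [k [Pk ik jk]] := dir i j Pi Pj.
    have [Akx Aky] : lin_span (A k) x /\ lin_span (A k) y.
      by split; [apply: span_mono Aix|apply: span_mono Ajy].
    have Akxy : lin_span (A k) (c *: x + y) := (span_subspace _).2 _ _ _ Akx Aky.
    by rewrite !(gfE k) //; apply: (fm k Pk).1.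
  rewrite RE => -[i Pi Aia]; rewrite (gfE i) //; last exact: span_incl.
  exact: (fm i Pi).2.
- move=> g' _ g'E x; rewrite inE => /spanR[i Pi Aix].
  by rewrite (gfE i) // (g'E i) // inE.
Qed.

Lemma lie_direct_limit_union (L : lieAlgType F) (A : I -> set L) (B : set L) :
    (forall i, P i -> is_subalgebra (A i)) ->
  directed_family P A -> B = \bigcup_(i in P) A i -> lie_direct_limit P A B.
Proof.
move=> subA [_ dir] BE; split => // M f fm fc.
have [|g gE] := @directed_glue _ _ _ (0 : M) P A f.
  move=> i j Pi Pj; have [k [Pk ik jk]] := dir i j Pi Pj.
  by exists k; split => //; apply: fc.
have gfE i x : P i -> A i x -> g x = f i x.
  by move=> Pi Aix; apply: gE => //; rewrite inE.
have common x y : B x -> B y -> exists k, [/\ P k, A k x & A k y].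
  rewrite BE => -[i Pi Aix] [j Pj Ajy]; have [k [Pk ik jk]] := dir i j Pi Pj.
  by exists k; split; [|apply: ik|apply: jk].
exists g; split => //.
- split=> [c x y Bx By _|x y Bx By]; have [k [Pk Ax Ay]] := common x y Bx By.
    have Axy : A k (c *: x + y) := (subA k Pk).1.2 _ _ _ Ax Ay.
    by rewrite !(gfE k) //; apply: (fm k Pk).1.
  have Axy : A k [lie x, y] := (subA k Pk).2 _ _ Ax Ay.
  by rewrite !(gfE k) //; apply: (fm k Pk).2.
- move=> g' _ g'E x; rewrite inE BE => -[i Pi Aix].
  by rewrite (gfE i) // (g'E i) // inE.
Qed.

End DirectLimits.

Section Exhaustion.
Variables (F : fieldType) (L : lieAlgType F) (H : set L).
Hypothesis char0 : [pchar F] =i pred0.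
Hypothesis Llf : locally_finite_lie [set: L].
Hypothesis Lsimple : simple_lie [set: L].
Hypothesis adm : admissible [set: L] H.

Local Notation R := (root_system [set: L] H).
Local Notation wt := (weight_space [set: L] H).
Local Notation W := (lin_span R).
Local Notation LS := (root_subalgebra [set: L] H).
Local Notation subsystems := (fin_irr_closed_subsystem W R).

Implicit Types (a b c : dual H) (S : set (dual H)).

Lemma conn_mono S S' a b : S `<=` S' -> connected_in W R S a b -> connected_in W R S' a b.
Proof. by move=> SS' [s [sS ps sb]]; exists s; split => // c /sS /SS'. Qed.

Lemma conn_prefix a b (s : seq (dual H)) : path (fun x y => coroot W R y x != 0) a s ->
  b \in a :: s -> connected_in W R [set` a :: s] a b.
Proof.
move=> ps sb; case/splitPl: sb ps => p1 p2 pb; rewrite cat_path => /andP[p1s _].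
exists p1; split => // c; rewrite inE => /predU1P[->|cp] /=; first exact: mem_head.
by rewrite inE mem_cat cp orbT.
Qed.

(** Adjoin to T chains of roots that join its elements to a0. *)
Lemma connected_hull a0 (T : seq (dual H)) : R a0 -> (forall t, t \in T -> R t) ->
  exists T' : seq (dual H), [/\ a0 \in T', {subset T <= T'}, (forall t, t \in T' -> R t) &
    forall t, t \in T' -> connected_in W R [set` T'] a0 t].
Proof.
move=> Ra0; elim: T => [_|t T IH TR].
  exists [:: a0]; split; rewrite ?inE // => t; rewrite inE => /eqP-> //.
  by exists [::]; split => // c.
have [|T' [T'a0 TT' T'R T'c]] := IH; first by move=> u Tu; apply: TR; rewrite inE Tu orbT.
have Rt : R t by apply: TR; apply: mem_head.
have [s [sR ps st]] := roots_irreducible char0 Llf adm Lsimple Ra0 Rt.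
exists ((a0 :: s) ++ T'); split.
- by rewrite mem_cat mem_head.
- move=> u; rewrite inE => /predU1P[->|/TT' T'u]; last by rewrite mem_cat T'u orbT.
  by rewrite mem_cat -st mem_last.
- by move=> u; rewrite mem_cat => /orP[/sR|/T'R].
move=> u; rewrite mem_cat => /orP[su|T'u].
  by apply: conn_mono (conn_prefix ps su) => c /= sc; rewrite -cat_cons mem_cat sc.
by apply: conn_mono (T'c u T'u) => c /= T'c'; rewrite -cat_cons mem_cat T'c' orbT.
Qed.

(** A root in the span of T' that is orthogonal to all coroots of T' has, by
    symmetry of orthogonality, a coroot that vanishes on T', on its span, and so
    on the root itself, which is impossible. Hence every root of the span is joined
    to T'. *)
Lemma finite_roots_in_subsystem (T : seq (dual H)) : (forall t, t \in T -> R t) ->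
  exists S, subsystems S /\ forall t, t \in T -> S t.
Proof.
move=> TR; have [a0 Ra0] := ex_root adm.
have [T' [T'a0 TT' T'R T'c]] := connected_hull Ra0 TR.
pose S := R `&` lin_span [set` T'].
have ST' t : t \in T' -> S t by move=> T't; split; [apply: T'R|apply: span_incl].
have SR : S `<=` R by move=> a [].
have sub := span_subspace [set` T'].
have toT' a : S a -> connected_in W R S a0 a.
  move=> [Ra Ta]; have [t T't at0] : exists2 t, t \in T' & t (coroot_elt a) != 0.
    apply: contrapT => nt; have : [set b : dual H | b (coroot_elt a) = 0] a.
      apply: (span_min _ _ Ta).
        split=> [|k b c /= b0 c0]; first exact: dual0.
        transitivity (k * (b : dual H) (coroot_elt a) + (c : dual H) (coroot_elt a) : F); first by [].
        by rewrite [X in k * X + _]b0 c0 mulr0 addr0.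
      by move=> t T't; apply: contrapT => /eqP ta; apply: nt; exists t.
    by rewrite /= (coroot_elt_diag adm Ra) => /eqP; rewrite (natF_eq0 char0 2).
  apply: (conn_trans (b := t)).
    by apply: conn_mono (T'c t T't) => u; apply: ST'.
  by apply: (conn_step char0 Llf adm SR) => //; apply: ST'.
exists S; split; last by move=> t /TT' /ST'.
split.
- split=> [||a b [Ra Ta] [Rb Tb]]; [by exists a0; apply: ST'|exact: SR|].
  rewrite /reflection (corootE char0 Llf adm) //; split.
    exact: (root_reflection char0 Llf adm).
  by rewrite addrC -scaleNr; exact: (sub.2 _ _ _ Ta Tb).
- exact: (roots_in_span_finite char0 Llf adm T'R).
- move=> a b Sa Sb; apply: (conn_trans (b := a0)); last exact: toT'.
  by apply: (conn_sym char0 Llf adm SR); apply: toT'.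
- move=> a b [Ra Ta] [Rb Tb] Rab; split => //.
  exact: (subspaceD sub Ta Tb).
Qed.

Lemma subsystems_directed : directed_family subsystems id.
Proof.
split.
  have [a Ra] := ex_root adm.
  have [|S [IS _]] := @finite_roots_in_subsystem [:: a]; last by exists S.
  by move=> t; rewrite inE => /eqP->.
move=> S1 S2 IS1 IS2.
have /finite_seqP[s1 E1] := S_finite IS1; have /finite_seqP[s2 E2] := S_finite IS2.
have [|S [IS TS]] := @finite_roots_in_subsystem (s1 ++ s2).
  move=> t; rewrite mem_cat => /orP[ts|ts].
    by apply: (S_roots IS1); rewrite E1.
  by apply: (S_roots IS2); rewrite E2.
exists S; split => //= t.
  by rewrite E1 => ts; apply: TS; rewrite mem_cat; apply/orP; left.
by rewrite E2 => ts; apply: TS; rewrite mem_cat; apply/orP; right.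
Qed.

Lemma LS_directed : directed_family subsystems LS.
Proof.
have [ne dir] := subsystems_directed; split => // S1 S2 I1 I2.
by have [S [IS h1 h2]] := dir S1 S2 I1 I2; exists S; split => //; apply: LS_mono.
Qed.

Lemma root_in_subsystem a : R a -> exists2 S, subsystems S & S a.
Proof.
move=> Ra; have [|S [IS TS]] := @finite_roots_in_subsystem [:: a].
  by move=> t; rewrite inE => /eqP->.
by exists S => //; apply: TS; rewrite inE.
Qed.

Lemma roots_union : R = \bigcup_(S in subsystems) id S.
Proof.
apply/seteqP; split=> [a /root_in_subsystem[S IS Sa]|a [S IS]]; first by exists S.
exact: (S_roots IS).
Qed.

Lemma LS_union : [set: L] = \bigcup_(S in subsystems) LS S.
Proof.
apply/seteqP; split => // x _.
have [[S0 IS0] dir] := LS_directed.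
have : LS R x by rewrite (LS_all_roots char0 Llf adm).
apply: LS_min.
- split; first by exists S0 => //; apply: (subspace0 (LS_subspace S0)).
  move=> k u v [S1 I1 Su] [S2 I2 Sv]; have [S [IS h1 h2]] := dir _ _ I1 I2.
  by exists S => //; exact: ((LS_subspace S).2 _ _ _ (h1 _ Su) (h2 _ Sv)).
- by move=> a u /root_in_subsystem[S IS Sa] au; exists S => //; apply: wt_LS au.
- move=> a u v /root_in_subsystem[S IS Sa] au av; exists S => //.
  by apply: cartan_LS; apply: cartan_bracket au av.
Qed.

Hypothesis Lfin : forall a, root_system [set: L] H a ->
      fin_dim (weight_space [set: L] H a).

(** An element t of a toral subalgebra containing H centralizes H, so lies in some
    L_S, and H' meets L_S in a toral subalgebra of L_S containing H_S. *)
Lemma H_maximal_toral : maximal_toral [set: L] H.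
Proof.
split; first by case: adm.
move=> H' torH' HH'; apply/seteqP; split => // t H't.
have [aH' _ _ gen' _] := torH'.
have ab' := toral_abelian (subalgebra_setT L) torH'.
have C' u : H' u -> wt 0 u.
  by move=> H'u; apply: centralizer_weight0 => // h /HH' H'h; apply: ab'.
have [S IS St] : (\bigcup_(S in subsystems) LS S) t by rewrite -LS_union.
have subS := LS_subalgebra char0 Llf adm IS.
have [_ maxS] := HS_maximal_toral char0 Llf Lsimple adm Lfin IS.
suff tor : toral (LS S) (H' `&` LS S).
  have HH'S : H `&` LS S `<=` H' `&` LS S by move=> h [/HH' H'h Sh]; split.
  have : (H' `&` LS S) t by [].
  by rewrite (maxS _ tor HH'S) => -[].
split.
- split=> [|x y [Hx Sx] [Hy Sy]]; first exact: subspaceI aH'.1 subS.1.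
  by split; [apply: aH'.2|apply: subS.2].
- exact: subIsetr.
- have [_ _ [h [Hh Sh] h0] _ _] := HS_toral char0 adm IS.
  by exists h => //; split => //; apply: HH'.
- apply/seteqP; split; first by apply: span_min; [exact: subS.1|move=> x [a _ []]].
  move=> x Sx; have : subspace_sum setT (weight_space [set: L] H') x by rewrite gen'.
  have sw (d : dual H') : is_subspace (weight_space [set: L] H' d) by apply: weight_subspace.
  move=> /(subspace_sum_comb sw)[r [v [ur _ vw xE]]].
  have Sv d : d \in r -> LS S (v d).
    apply: (@weight_components _ _ H' (LS S) _ (fun d : dual H' => d : L -> F)) => //.
    + exact: subS.1.
    + by move=> h u /C' h0; apply: LS_bracket_wt0.
    + by move=> e f _ _; apply: dual_neq.
    + by move=> e h _ H'h; have [_ E] := vw e; exact: E.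
    + by rewrite -xE.
  rewrite xE; apply: (subspace_big (span_subspace _)) => d rd _; apply: span_incl.
  exists (restrict_dual (LS S) d) => //; split; first exact: Sv.
  by move=> h [H'h Sh]; rewrite restrict_dualE //; have [_ E] := vw d; exact: E.
- exact: weight_independent.
Qed.

End Exhaustion.

Theorem theorem2p37 (F : fieldType) (char0 : [pchar F] =i pred0)
    (L : lieAlgType F) (H : set L)
    (Llf : locally_finite_lie [set: L])
    (Lsimple : simple_lie [set: L])
    (LHadm : admissible [set: L] H)
    (Lfin : forall a, root_system [set: L] H a ->
      fin_dim (weight_space [set: L] H a)) :
  let R := root_system [set: L] H in
  let W := lin_span R in
  let I := fin_irr_closed_subsystem W R in
  let Lsub S := root_subalgebra [set: L] H S in
  let Hsub S := H `&` Lsub S in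
  (lf_root_system W R /\ irreducible_in W R R) /\
  maximal_toral [set: L] H /\
  (forall S, I S ->
     cartan_part [set: L] H S `&` root_part [set: L] H S = [set 0] /\
     is_subalgebra (Lsub S) /\
     maximal_toral (Lsub S) (Hsub S) /\
     fin_dim (Lsub S) /\
     simple_lie (Lsub S) /\
     admissible (Lsub S) (Hsub S) /\
     set_inj S (restrict_dual (Lsub S)) /\
     root_system (Lsub S) (Hsub S) = restrict_dual (Lsub S) @` S) /\
  directed_family I id /\
  directed_family I Lsub /\
  rs_direct_limit I id R /\
  lie_direct_limit I Lsub [set: L].
Proof.
move=> R W I Lsub Hsub; split.
  by split; [apply: roots_lf_root_system|apply: roots_irreducible].
split; first exact: H_maximal_toral.
split.
  move=> S IS; split; first exact: cartan_root_disjoint IS.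
  split; first exact: LS_subalgebra IS.
  split; first exact: HS_maximal_toral IS.
  split.
    by apply: (LS_fin_dim Lfin (S_finite IS) (S_roots IS)); apply: S_opp IS.
  split; first exact: LS_simple IS.
  split; first exact: LS_admissible IS.
  split; last exact: LS_root_system IS.
  move=> a b; rewrite !inE => Sa Sb.
  by apply: (restr_inj char0 Llf LHadm IS); left.
split; first exact: subsystems_directed.
split; first exact: LS_directed.
split.
  by apply: rs_direct_limit_union; [apply: subsystems_directed|apply: roots_union].
apply: lie_direct_limit_union; [|exact: LS_directed|exact: LS_union].
by move=> S IS; apply: LS_subalgebra IS.
Qed.
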